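(* Let $\mathcal{G}$ be a Grothendieck category having a noetherian generator. Assume that $\mathcal{G}$ is atomically reduced. Denote by $i^{*}\colon\mathcal{G}\to\mathcal{G}_{\mathrm{Goldie}}$ the canonical functor. Let $U$ be a noetherian generator in $\mathcal{G}$ that is nonsingular and essentially compressible. (1) $\operatorname{End}_{\mathcal{G}_{\mathrm{Goldie}}}(i^{*}U)$ is a classical right quotient ring of $\operatorname{End}_{\mathcal{G}}(U)$ via the ring homomorphism $i^{*}\colon\operatorname{End}_{\mathcal{G}}(U)\to\operatorname{End}_{\mathcal{G}_{\mathrm{Goldie}}}(i^{*}U)$. (2) $\operatorname{End}_{\mathcal{G}_{\mathrm{Goldie}}}(i^{*}U)$ is a semisimple artinian ring. (3) There is an equivalence $\operatorname{Hom}_{\mathcal{G}_{\mathrm{Goldie}}}(i^{*}U,-)\colon\mathcal{G}_{\mathrm{Goldie}}\to\operatorname{Mod}\operatorname{End}_{\mathcal{G}_{\mathrm{Goldie}}}(i^{*}U)$.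
   Context: All subcategories are full; rings are associative with identity; $\operatorname{Mod}\Lambda$ is the category of right $\Lambda$-modules; the product in an endomorphism ring is composition. A weakly closed subcategory of a Grothendieck category $\mathcal{G}$ is a full subcategory closed under subobjects, quotient objects and (small) direct sums; a localizing subcategory is a weakly closed subcategory closed under extensions. For a localizing subcategory $\mathcal{X}$, $\mathcal{G}/\mathcal{X}$ is the (Gabriel) quotient category, with exact canonical functor $i^*\colon\mathcal{G}\to\mathcal{G}/\mathcal{X}$. Atomic reducedness. A nonzero object $H$ is monoform if for every nonzero subobject $L\subset H$, no nonzero subobject of $H$ is isomorphic to a subobject of $H/L$. Monoform objects are atom-equivalent if they have isomorphic nonzero subobjects; $\operatorname{ASpec}\mathcal{G}$ is the set of equivalence classes $\overline{H}$ of monoform objects. For a full subcategory $\mathcal{Y}$, $\operatorname{ASupp}\mathcal{Y}$ is the set of all $\overline{H}$ with $H$ a monoform subquotient of some $M\in\mathcal{Y}$. When $\mathcal{G}$ has a noetherian generator there is a smallest weakly closed subcategory $\mathcal{G}_{\mathrm{a\text{-}red}}$ among the weakly closed $\mathcal{W}$ with $\operatorname{ASupp}\mathcal{W}=\operatorname{ASpec}\mathcal{G}$; $\mathcal{G}$ is atomically reduced if $\mathcal{G}_{\mathrm{a\text{-}red}}=\mathcal{G}$. Goldie quotient. The Goldie weakly closed subcategory $\mathcal{W}$ of $\mathcal{G}$ consists of all objects isomorphic to $M/L$ with $L$ an essential subobject of an object $M$; it is weakly closed. The Goldie localizing subcategory is $\mathcal{X}=\mathcal{W}*\mathcal{W}$,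 the full subcategory of all $M$ admitting a short exact sequence $0\to M_1\to M\to M_2\to0$ with $M_1,M_2\in\mathcal{W}$; it is localizing. $\mathcal{G}_{\mathrm{Goldie}}:=\mathcal{G}/\mathcal{X}$. An object is nonsingular if it has no nonzero subobject belonging to $\mathcal{W}$. An object $M$ is essentially compressible if each essential subobject of $M$ has a subobject isomorphic to $M$. Classical right quotient ring. An element $a$ of a ring $\Lambda$ is regular if $ab\ne0$ and $ba\ne0$ for all $0\ne b\in\Lambda$. A classical right quotient ring of $\Lambda$ is a ring $\Gamma$ with a ring homomorphism $f\colon\Lambda\to\Gamma$ such that $f$ is injective; $f(a)$ is invertible for every regular $a\in\Lambda$; and every $q\in\Gamma$ is of the form $q=f(a)f(s)^{-1}$ with $a,s\in\Lambda$ and $s$ regular. *)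

(* Defs.v *)
From HB Require Import structures.
From mathcomp Require Import all_boot all_algebra.
From mathcomp Require Import boolp.

Set Implicit Arguments.
Unset Strict Implicit.
Unset Printing Implicit Defensive.

Import GRing.Theory.
Local Open Scope ring_scope.

(* Small sets are the types in the universe of carriers of abelian groups: the
   preadditive categories below are locally small with respect to exactly the
   sets that index their coproducts and direct limits. *)
Notation small_set := Type@{Algebra.Zmodule.axioms_.u0} (only parsing).

Record category := Category {
  cobj :> Type;
  chom : cobj -> cobj -> Type;
  cid : forall X, chom X X;
  ccomp : forall X Y Z, chom Y Z -> chom X Y -> chom X Z;
  ccompA : forall X Y Z T (h : chom Z T) (g : chom Y Z) (f : chom X Y),
    ccomp h (ccomp g f) = ccomp (ccomp h g) f;
  ccomp1m : forall X Y (f : chom X Y), ccomp (cid Y) f = f;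
  ccompm1 : forall X Y (f : chom X Y), ccomp f (cid X) = f
}.

Record functor (C D : category) := Functor {
  fobj :> C -> D;
  fmap : forall X Y, chom X Y -> chom (fobj X) (fobj Y);
  fmap1 : forall X, fmap (cid X) = cid (fobj X);
  fmapM : forall X Y Z (g : chom Y Z) (f : chom X Y),
    fmap (ccomp g f) = ccomp (fmap g) (fmap f)
}.

Definition functor_id (C : category) : functor C C :=
  @Functor C C id (fun _ _ f => f) (fun _ => erefl) (fun _ _ _ _ _ => erefl).

Lemma functor_comp1 (C D E : category) (G : functor D E) (F : functor C D) X :
  fmap G (fmap F (cid X)) = cid (G (F X)).
Proof. by rewrite !fmap1. Qed.

Lemma functor_compM (C D E : category) (G : functor D E) (F : functor C D)
    X Y Z (g : chom Y Z) (f : chom X Y) :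
  fmap G (fmap F (ccomp g f)) = ccomp (fmap G (fmap F g)) (fmap G (fmap F f)).
Proof. by rewrite !fmapM. Qed.

Definition functor_comp (C D E : category) (G : functor D E) (F : functor C D) :
  functor C E :=
  @Functor C E (fun X => G (F X)) (fun _ _ f => fmap G (fmap F f))
    (functor_comp1 G F) (functor_compM G F).

Definition naturally_isomorphic (C D : category) (F G : functor C D) : Prop :=
  exists (a : forall X : C, chom (F X) (G X)) (b : forall X : C, chom (G X) (F X)),
    [/\ forall X Y (f : chom X Y), ccomp (a Y) (fmap F f) = ccomp (fmap G f) (a X),
        forall X, ccomp (b X) (a X) = cid (F X)
      & forall X, ccomp (a X) (b X) = cid (G X)].

Definition is_equivalence (C D : category) (F : functor C D) : Prop :=
  exists G : functor D C,
    naturally_isomorphic (functor_comp G F) (functor_id C) /\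
    naturally_isomorphic (functor_comp F G) (functor_id D).

Record preadditive := Preadditive {
  pobj :> Type;
  phom : pobj -> pobj -> zmodType;
  idm : forall X, phom X X;
  mcomp : forall X Y Z, phom Y Z -> phom X Y -> phom X Z;
  mcompA : forall X Y Z T (h : phom Z T) (g : phom Y Z) (f : phom X Y),
    mcomp h (mcomp g f) = mcomp (mcomp h g) f;
  mcomp1l : forall X Y (f : phom X Y), mcomp (idm Y) f = f;
  mcomp1r : forall X Y (f : phom X Y), mcomp f (idm X) = f;
  mcompDl : forall X Y Z (g g' : phom Y Z) (f : phom X Y),
    mcomp (g + g') f = mcomp g f + mcomp g' f;
  mcompDr : forall X Y Z (g : phom Y Z) (f f' : phom X Y),
    mcomp g (f + f') = mcomp g f + mcomp g f'
}.

Notation "g ∘ f" := (mcomp g f) (at level 40, left associativity).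

Definition category_of (C : preadditive) : category :=
  @Category C (fun X Y => phom X Y : Type) (@idm C) (@mcomp C)
    (@mcompA C) (@mcomp1l C) (@mcomp1r C).

Record additive_functor (C D : preadditive) := AdditiveFunctor {
  aobj :> C -> D;
  amap : forall X Y, phom X Y -> phom (aobj X) (aobj Y);
  amap1 : forall X, amap (idm X) = idm (aobj X);
  amapM : forall X Y Z (g : phom Y Z) (f : phom X Y),
    amap (g ∘ f) = amap g ∘ amap f;
  amapD : forall X Y (f g : phom X Y), amap (f + g) = amap f + amap g
}.

Section Preadditive.
Variable C : preadditive.
Implicit Types X Y Z M N : C.

Definition zero_object M : Prop :=
  forall X, (forall f : phom M X, f = 0) /\ (forall f : phom X M, f = 0).

Definition mono X Y (f : phom X Y) : Prop :=
  forall Z (u v : phom Z X), f ∘ u = f ∘ v -> u = v.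

Definition epi X Y (f : phom X Y) : Prop :=
  forall Z (u v : phom Y Z), u ∘ f = v ∘ f -> u = v.

Definition iso X Y (f : phom X Y) : Prop :=
  exists g : phom Y X, g ∘ f = idm X /\ f ∘ g = idm Y.

Definition isomorphic X Y : Prop := exists f : phom X Y, iso f.

Definition is_kernel X Y Z (f : phom Y Z) (k : phom X Y) : Prop :=
  f ∘ k = 0 /\
  forall T (t : phom T Y), f ∘ t = 0 -> exists! u : phom T X, k ∘ u = t.

Definition is_cokernel X Y Z (f : phom X Y) (c : phom Y Z) : Prop :=
  c ∘ f = 0 /\
  forall T (t : phom Y T), t ∘ f = 0 -> exists! u : phom Z T, u ∘ c = t.

Definition short_exact X Y Z (f : phom X Y) (g : phom Y Z) : Prop :=
  is_kernel g f /\ is_cokernel f g.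

Definition is_biproduct X Y P (i1 : phom X P) (i2 : phom Y P)
    (p1 : phom P X) (p2 : phom P Y) : Prop :=
  [/\ p1 ∘ i1 = idm X, p2 ∘ i2 = idm Y, p1 ∘ i2 = 0, p2 ∘ i1 = 0
    & i1 ∘ p1 + i2 ∘ p2 = idm P].

Definition abelian_category : Prop :=
  (exists O : C, zero_object O) /\
  (forall X Y, exists P (i1 : phom X P) (i2 : phom Y P) (p1 : phom P X) (p2 : phom P Y),
     is_biproduct i1 i2 p1 p2) /\
  (forall X Y (f : phom X Y), exists K (k : phom K X), is_kernel f k) /\
  (forall X Y (f : phom X Y), exists Q (c : phom Y Q), is_cokernel f c) /\
  (forall X Y (m : phom X Y), mono m -> exists Z (c : phom Y Z), is_kernel c m) /\
  (forall X Y (e : phom X Y), epi e -> exists Z (k : phom Z X), is_cokernel k e).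

Definition is_coproduct (I : small_set) (F : I -> C) S
    (inj : forall i, phom (F i) S) : Prop :=
  forall X (f : forall i, phom (F i) X),
    exists! u : phom S X, forall i, u ∘ inj i = f i.

Definition has_coproducts : Prop :=
  forall (I : small_set) (F : I -> C),
    exists S (inj : forall i, phom (F i) S), is_coproduct inj.

Definition directed (I : small_set) (le : I -> I -> Prop) : Prop :=
  [/\ inhabited I, forall i, le i i,
      forall i j k, le i j -> le j k -> le i k
    & forall i j, exists k, le i k /\ le j k].

Record direct_system (I : small_set) (le : I -> I -> Prop) := DirectSystem {
  dobj :> I -> C;
  dmap : forall i j, le i j -> phom (dobj i) (dobj j);
  dmap1 : forall i (p : le i i), dmap p = idm (dobj i);
  dmapM : forall i j k (p : le i j) (q : le j k) (r : le i k),
    dmap r = dmap q ∘ dmap p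
}.

Definition cocone I le (D : @direct_system I le) L
    (c : forall i, phom (D i) L) : Prop :=
  forall i j (p : le i j), c j ∘ dmap D p = c i.

Definition is_direct_limit I le (D : @direct_system I le) L
    (c : forall i, phom (D i) L) : Prop :=
  cocone c /\
  forall X (d : forall i, phom (D i) X), cocone d ->
    exists! u : phom L X, forall i, u ∘ c i = d i.

Definition system_map I le (D E : @direct_system I le)
    (f : forall i, phom (D i) (E i)) : Prop :=
  forall i j (p : le i j), f j ∘ dmap D p = dmap E p ∘ f i.

Definition exact_direct_limits : Prop :=
  forall (I : small_set) (le : I -> I -> Prop), directed le ->
  forall (D1 D2 D3 : direct_system le)
    (f : forall i, phom (D1 i) (D2 i)) (g : forall i, phom (D2 i) (D3 i)),
    system_map f -> system_map g -> (forall i, short_exact (f i) (g i)) ->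
  forall (L1 L2 L3 : C) (c1 : forall i, phom (D1 i) L1)
    (c2 : forall i, phom (D2 i) L2) (c3 : forall i, phom (D3 i) L3),
    is_direct_limit c1 -> is_direct_limit c2 -> is_direct_limit c3 ->
  forall (lf : phom L1 L2) (lg : phom L2 L3),
    (forall i, lf ∘ c1 i = c2 i ∘ f i) -> (forall i, lg ∘ c2 i = c3 i ∘ g i) ->
    short_exact lf lg.

Definition generator U : Prop :=
  forall M N (f g : phom M N), f <> g -> exists h : phom U M, f ∘ h <> g ∘ h.

Definition grothendieck_category : Prop :=
  [/\ abelian_category, has_coproducts, exact_direct_limits
    & exists U, generator U].

Record subobject M := Subobject {
  sdom :> C;
  sincl : phom sdom M;
  sincl_mono : mono sincl
}.

Definition sub_le M (K L : subobject M) : Prop :=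
  exists u : phom K L, sincl L ∘ u = sincl K.

Definition is_intersection M (K L D : subobject M) : Prop :=
  [/\ sub_le D K, sub_le D L
    & forall E : subobject M, sub_le E K -> sub_le E L -> sub_le E D].

Definition essential M (L : subobject M) : Prop :=
  forall K D : subobject M,
    is_intersection L K D -> ~ zero_object K -> ~ zero_object D.

Definition subquotient H M : Prop :=
  exists (L : subobject M) (p : phom L H), epi p.

Definition noetherian M : Prop :=
  forall s : nat -> subobject M, (forall n, sub_le (s n) (s n.+1)) ->
  exists n, forall m, (n <= m)%N -> sub_le (s m) (s n).

Definition essentially_compressible M : Prop :=
  forall L : subobject M, essential L -> exists K : subobject L, isomorphic K M.

Definition weakly_closed (W : C -> Prop) : Prop :=
  [/\ forall M (L : subobject M), W M -> W L,
      forall M N (p : phom M N), epi p -> W M -> W N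
    & forall (I : small_set) (F : I -> C) S (inj : forall i, phom (F i) S),
        is_coproduct inj -> (forall i, W (F i)) -> W S].

Definition localizing (X : C -> Prop) : Prop :=
  weakly_closed X /\
  forall M1 M M2 (f : phom M1 M) (g : phom M M2),
    short_exact f g -> X M1 -> X M2 -> X M.

Definition extension_product (W1 W2 : C -> Prop) (M : C) : Prop :=
  exists M1 M2 (f : phom M1 M) (g : phom M M2),
    [/\ short_exact f g, W1 M1 & W2 M2].

Definition monoform H : Prop :=
  ~ zero_object H /\
  forall (L : subobject H) Q (q : phom H Q), ~ zero_object L ->
    is_cokernel (sincl L) q ->
    forall (K : subobject H) (K' : subobject Q),
      ~ zero_object K -> ~ isomorphic K K'.

Definition atom_equivalent H H' : Prop :=
  exists (L : subobject H) (L' : subobject H'),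
    ~ zero_object L /\ isomorphic L L'.

Definition atom H : C -> Prop :=
  fun K => monoform K /\ atom_equivalent H K.

Definition ASpec (a : C -> Prop) : Prop :=
  exists H, monoform H /\ a = atom H.

Definition ASupp (Y : C -> Prop) (a : C -> Prop) : Prop :=
  exists H M, [/\ Y M, monoform H, subquotient H M & a = atom H].

Definition atomically_full (W : C -> Prop) : Prop :=
  weakly_closed W /\ forall a, ASupp W a <-> ASpec a.

Definition is_atomically_reduced_part (W : C -> Prop) : Prop :=
  atomically_full W /\
  forall W' : C -> Prop, atomically_full W' -> forall M, W M -> W' M.

Definition atomically_reduced : Prop :=
  is_atomically_reduced_part (fun _ => True).

Definition goldie_weakly_closed (M : C) : Prop :=
  exists N (L : subobject N) (q : phom N M),
    essential L /\ is_cokernel (sincl L) q.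

Definition goldie_localizing : C -> Prop :=
  extension_product goldie_weakly_closed goldie_weakly_closed.

Definition nonsingular M : Prop :=
  forall L : subobject M, goldie_weakly_closed L -> zero_object L.

Definition mono_mod (X : C -> Prop) M N (m : phom M N) : Prop :=
  mono m /\ exists Q (c : phom N Q), is_cokernel m c /\ X Q.

Definition epi_mod (X : C -> Prop) M N (p : phom M N) : Prop :=
  epi p /\ exists K (k : phom K M), is_kernel p k /\ X K.

End Preadditive.

(* [T : G -> Q] is the canonical functor to Gabriel's quotient [G/X]: [Q] has
   the objects of [G] and [Hom_Q(M, N)] is the direct limit of the groups
   [Hom_G(M', N/N')] over the subobjects [M'] of [M] and [N'] of [N] with [M/M']
   and [N'] in [X]. The structure map of this direct limit at
   [m : M' -> M], [p : N -> N/N'] is [f |-> (T p)^-1 ∘ T f ∘ (T m)^-1]; the last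
   two clauses say that these maps are jointly surjective, and that an element
   is killed by one of them iff it dies at a later stage of the limit.
   This determines [(Q, T)] up to a unique isomorphism of categories. Using a
   characterization rather than classes of triples keeps the Hom groups small. *)
Definition is_gabriel_quotient (G Q : preadditive) (X : G -> Prop)
    (T : additive_functor G Q) : Prop :=
  [/\ bijective (aobj T),
      forall M N (m : phom M N), mono_mod X m -> iso (amap T m),
      forall M N (p : phom M N), epi_mod X p -> iso (amap T p),
      forall (M N : G) (phi : phom (T M) (T N)),
        exists (M' N' : G) (m : phom M' M) (p : phom N N') (f : phom M' N'),
          [/\ mono_mod X m, epi_mod X p & amap T p ∘ phi ∘ amap T m = amap T f]
    & forall (M N : G) (f : phom M N), amap T f = 0 ->
        exists (M' N' : G) (m : phom M' M) (p : phom N N'),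
          [/\ mono_mod X m, epi_mod X p & p ∘ f ∘ m = 0]].

Definition endo (C : preadditive) (M : C) : Type := phom M M.

HB.instance Definition _ (C : preadditive) (M : C) :=
  GRing.Zmodule.on (@endo C M).
HB.instance Definition _ (C : preadditive) (M : C) :=
  GRing.Zmodule_isPzRing.Build (@endo C M)
    (@mcompA C M M M M) (@mcomp1l C M M) (@mcomp1r C M M)
    (@mcompDl C M M M) (@mcompDr C M M M).

Definition endo_map (C D : preadditive) (T : additive_functor C D) (M : C) :
  endo M -> endo (T M) := @amap C D T M M.
Arguments endo_map {C D} T {M} _.

Lemma endo_map_is_additive C D (T : additive_functor C D) M :
  zmod_morphism (@endo_map C D T M).
Proof.
move=> f g; apply: (addIr (endo_map T g)); rewrite subrK.
by rewrite -[LHS](@amapD C D T M M (f - g) g) subrK.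
Qed.

Lemma endo_map_is_multiplicative C D (T : additive_functor C D) M :
  monoid_morphism (@endo_map C D T M).
Proof. by split; [exact: amap1 | move=> f g; exact: amapM]. Qed.

HB.instance Definition _ C D (T : additive_functor C D) M :=
  GRing.isZmodMorphism.Build _ _ (@endo_map C D T M)
    (@endo_map_is_additive C D T M).
HB.instance Definition _ C D (T : additive_functor C D) M :=
  GRing.isMonoidMorphism.Build _ _ (@endo_map C D T M)
    (@endo_map_is_multiplicative C D T M).

Section ModCategory.
Variable R : pzRingType.
Implicit Types A B D : lmodType R^c.

Lemma linear_map_eq A B (f g : {linear A -> B}) : (f : A -> B) = g -> f = g.
Proof.
case: f g => [f fP] [g gP] /= efg; rewrite -{}efg in gP *.
case: fP gP => -[fz] [fs] [-[gz] [gs]].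
congr (GRing.Linear.Pack (GRing.Linear.Class _ _)).
all: by congr (_ _); exact: Prop_irrelevance.
Qed.

Definition Mod : category.
Proof.
refine (@Category (lmodType R^c) (fun A B => {linear A -> B})
  (fun A => idfun : {linear A -> A})
  (fun A B D g f => (g \o f : {linear A -> D})) _ _ _).
- by move=> *; apply: linear_map_eq.
- by move=> *; apply: linear_map_eq.
- by move=> *; apply: linear_map_eq.
Defined.

End ModCategory.

(* [phom V X] as a right module over [endo V]: the action is [f . a = f ∘ a]. *)
Definition hom_from (C : preadditive) (V X : C) : Type := phom V X.

HB.instance Definition _ (C : preadditive) (V X : C) :=
  GRing.Zmodule.on (@hom_from C V X).

Section HomModule.
Variables (C : preadditive) (V X : C).

Let act (a : (endo V)^c) (f : hom_from V X) : hom_from V X :=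
  (f : phom V X) ∘ (a : phom V V).

Lemma hom_actA (a b : (endo V)^c) f : act a (act b f) = act (a * b) f.
Proof. by rewrite /act -mcompA. Qed.

Lemma hom_act1 : left_id 1 act.
Proof. by move=> f; apply: mcomp1r. Qed.

Lemma hom_actDr : right_distributive act +%R.
Proof. by move=> a f g; apply: mcompDl. Qed.

Lemma hom_actDl f : {morph act^~ f : a b / a + b}.
Proof. by move=> a b; apply: mcompDr. Qed.

HB.instance Definition _ := GRing.Zmodule_isLmodule.Build (endo V)^c
  (hom_from V X) hom_actA hom_act1 hom_actDr hom_actDl.

End HomModule.

Definition hom_post (C : preadditive) (V X Y : C) (g : phom X Y)
  (f : hom_from V X) : hom_from V Y := g ∘ f.

Lemma hom_post_is_linear C V X Y g : linear (@hom_post C V X Y g).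
Proof. by move=> a f f'; rewrite /hom_post mcompDr mcompA. Qed.

HB.instance Definition _ C V X Y g :=
  GRing.isLinear.Build _ _ _ _ (@hom_post C V X Y g)
    (@hom_post_is_linear C V X Y g).

Definition hom_functor (C : preadditive) (V : C) :
  functor (category_of C) (Mod (endo V)).
Proof.
refine (@Functor (category_of C) (Mod (endo V))
  (fun X => hom_from V X : lmodType (endo V)^c)
  (fun X Y g => hom_post g : {linear hom_from V X -> hom_from V Y}) _ _).
- by move=> X; apply: linear_map_eq; apply: funext => f; apply: mcomp1l.
- move=> X Y Z g f; apply: linear_map_eq; apply: funext => h /=.
  by rewrite /hom_post /= -mcompA.
Defined.

Definition regular (R : pzRingType) (a : R) : Prop :=
  forall b : R, b <> 0 -> a * b <> 0 /\ b * a <> 0.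

Definition inverse_of (R : pzRingType) (a b : R) : Prop :=
  a * b = 1 /\ b * a = 1.

Definition is_classical_right_quotient_ring (R S : pzRingType)
    (f : {rmorphism R -> S}) : Prop :=
  [/\ injective f,
      forall a : R, regular a -> exists b : S, inverse_of (f a) b
    & forall q : S, exists (a s : R) (t : S),
        [/\ regular s, inverse_of (f s) t & q = f a * t]].

Definition right_ideal (R : pzRingType) (I : R -> Prop) : Prop :=
  [/\ I 0, forall x y, I x -> I y -> I (x + y) & forall x r, I x -> I (x * r)].

Definition simple_right_ideal (R : pzRingType) (I : R -> Prop) : Prop :=
  [/\ right_ideal I, exists x, I x /\ x <> 0
    & forall J : R -> Prop, right_ideal J -> (forall x, J x -> I x) ->
        (forall x, J x -> x = 0) \/ (forall x, I x -> J x)].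

(* The right module [R] is the sum of its simple submodules. *)
Definition semisimple (R : pzRingType) : Prop :=
  forall x : R, exists (n : nat) (I : 'I_n -> R -> Prop) (y : 'I_n -> R),
    (forall i, simple_right_ideal (I i) /\ I i (y i)) /\ x = \sum_(i < n) y i.

Definition right_artinian (R : pzRingType) : Prop :=
  forall I : nat -> R -> Prop, (forall n, right_ideal (I n)) ->
    (forall n x, I n.+1 x -> I n x) ->
  exists n, forall m, (n <= m)%N -> forall x, I n x -> I m x.

Definition artinian (R : pzRingType) : Prop :=
  right_artinian R /\ right_artinian R^c.

Definition semisimple_artinian (R : pzRingType) : Prop :=
  semisimple R /\ artinian R.

(* Main.v *)
From HB Require Import structures.
Require Import Defs.
From mathcomp Require Import all_boot all_algebra.
From mathcomp Require Import boolp.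

Set Implicit Arguments.
Unset Strict Implicit.
Unset Printing Implicit Defensive.

Import GRing.Theory.
Local Open Scope ring_scope.

(** The proof carries Goldie's theorem from rings to categories: monomorphisms
    [s : U -> U] play the role of regular elements, and computing in the Goldie
    quotient means computing with fractions whose denominators are such [s].

    A monomorphism [s : U -> U] is essential: a subobject [D] meeting the image
    of [s] trivially would give an infinite direct sum of the [s^n(D)] in the
    noetherian object [U] ([mono_ess]). By essential compressibility every
    essential subobject of [U] contains the image of a monomorphism [U -> U]
    ([compress]), and pulling back yields the Ore condition ([ore]). As [U] is
    nonsingular, a morphism [U -> U] killed by an essential subobject is zero
    ([ann_ess]). Although [U] need not be projective in [G], it is so up to
    denominators: if [p : P -> N] is epi, every [h : U -> N] satisfies
    [h s = p t] for some [t] and some monomorphism [s] ([lift_mod]); one takes a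
    maximal subobject of [U] on which a section exists, and finds it to be
    essential.

    Call [h : U -> M] torsion if [h s = 0] for a monomorphism [s : U -> U]. The
    Goldie localizing class consists of the [M] for which all [h : U -> M] are
    torsion ([tors_goldie], [goldie_tors]). With [T] the canonical functor, this
    gives [T h = 0] iff [h] is torsion ([amap_eq0]), [T s] is invertible for
    every monomorphism [s : U -> U], and each morphism [T U -> T M] has the form
    [T h (T s)^-1] ([fraction]). The first claim of the theorem is the case
    [M = U], because the regular elements of End U are the monomorphisms.

    For the second claim, let [J] be a right ideal of [E = End (T U)] and let
    [V] be a maximal subobject of [U] such that [T g] lies in [J] for all [g]
    with image in [V]. Then [J] consists of the fractions with numerators in
    [V], and since [V] is a retract of an essential subobject of [U], [J] is
    generated by an idempotent ([endo_idempotent_ideals]). A ring all of whose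
    right ideals are generated by idempotents is semisimple artinian
    ([idempotent_semisimple_artinian]).

    For the third claim, exactness of direct limits makes [U] small with respect
    to copowers ([copower_finite]). So morphisms out of [T U] are described by
    generators and relations: Hom (T U, -) is faithful since [U] generates
    ([hom_faithful]), full since an [E]-linear map can be assembled on a copower
    of [U] ([hom_full]), and essentially surjective since a presentation of an
    [E]-module by generators and relations is mirrored by a quotient of a copower
    of [U] ([hom_essentially_surjective]). *)

(** * Preadditive categories *)

Section Additivity.
Variable C : preadditive.
Implicit Types X Y Z : C.

Lemma comp0m X Y Z (f : phom X Y) : (0 : phom Y Z) ∘ f = 0.
Proof. by apply: (addIr (0 ∘ f)); rewrite -mcompDl !add0r. Qed.

Lemma compm0 X Y Z (g : phom Y Z) : g ∘ (0 : phom X Y) = 0.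
Proof. by apply: (addIr (g ∘ 0)); rewrite -mcompDr !add0r. Qed.

Lemma compNm X Y Z (g : phom Y Z) (f : phom X Y) : (- g) ∘ f = - (g ∘ f).
Proof. by apply: (addIr (g ∘ f)); rewrite -mcompDl !addNr comp0m. Qed.

Lemma compmN X Y Z (g : phom Y Z) (f : phom X Y) : g ∘ (- f) = - (g ∘ f).
Proof. by apply: (addIr (g ∘ f)); rewrite -mcompDr !addNr compm0. Qed.

Lemma compBm X Y Z (g g' : phom Y Z) (f : phom X Y) :
  (g - g') ∘ f = g ∘ f - g' ∘ f.
Proof. by rewrite mcompDl compNm. Qed.

Lemma compmB X Y Z (g : phom Y Z) (f f' : phom X Y) :
  g ∘ (f - f') = g ∘ f - g ∘ f'.
Proof. by rewrite mcompDr compmN. Qed.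

Lemma comp_suml X Y Z (I : Type) (r : seq I) (P : pred I)
    (g : I -> phom Y Z) (f : phom X Y) :
  (\sum_(i <- r | P i) g i) ∘ f = \sum_(i <- r | P i) (g i ∘ f).
Proof. by elim/big_rec2: _ => [|i x y _ <-]; rewrite ?comp0m ?mcompDl. Qed.

Lemma comp_sumr X Y Z (I : Type) (r : seq I) (P : pred I)
    (g : phom Y Z) (f : I -> phom X Y) :
  g ∘ (\sum_(i <- r | P i) f i) = \sum_(i <- r | P i) (g ∘ f i).
Proof. by elim/big_rec2: _ => [|i x y _ <-]; rewrite ?compm0 ?mcompDr. Qed.

Lemma mono0P X Y (f : phom X Y) :
  mono f <-> forall Z (u : phom Z X), f ∘ u = 0 -> u = 0.
Proof.
split=> [fM Z u fu0 | fM Z u v fuv]; first by apply: fM; rewrite fu0 compm0.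
by apply/subr0_eq/fM; rewrite compmB fuv subrr.
Qed.

Lemma epi0P X Y (f : phom X Y) :
  epi f <-> forall Z (u : phom Y Z), u ∘ f = 0 -> u = 0.
Proof.
split=> [fE Z u uf0 | fE Z u v fuv]; first by apply: fE; rewrite uf0 comp0m.
by apply/subr0_eq/fE; rewrite compBm fuv subrr.
Qed.

Lemma zero_objectP X : zero_object X <-> idm X = 0.
Proof.
split=> [/(_ X)[_ X0] | X0 Y]; first exact: X0.
by split=> f; [rewrite -[f]mcomp1r X0 compm0 | rewrite -[f]mcomp1l X0 comp0m].
Qed.

Lemma mono_neq0 X Y (f : phom X Y) : mono f -> ~ zero_object X <-> f <> 0.
Proof.
move=> /mono0P fM; split=> [X0 f0 | f0 X0]; last by apply: f0; case: (X0 Y).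
by apply/X0/zero_objectP/fM; rewrite f0 comp0m.
Qed.

Lemma mono_id X : mono (idm X).
Proof. by move=> Z u v; rewrite !mcomp1l. Qed.

Lemma mono_comp X Y Z (g : phom Y Z) (f : phom X Y) :
  mono g -> mono f -> mono (g ∘ f).
Proof. by move=> gM fM T u v; rewrite -!mcompA => /gM/fM. Qed.

Lemma mono_compR X Y Z (g : phom Y Z) (f : phom X Y) : mono (g ∘ f) -> mono f.
Proof. by move=> gfM T u v fuv; apply: gfM; rewrite -!mcompA fuv. Qed.

Lemma epi_comp X Y Z (g : phom Y Z) (f : phom X Y) :
  epi g -> epi f -> epi (g ∘ f).
Proof. by move=> gE fE T u v; rewrite !mcompA => /fE/gE. Qed.

Lemma iso_inv X Y (f : phom X Y) (g : phom Y X) :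
  g ∘ f = idm X -> f ∘ g = idm Y -> iso g.
Proof. by exists f. Qed.

Lemma iso_epi X Y (f : phom X Y) : iso f -> epi f.
Proof.
by case=> g [_ fg] Z u v uv; rewrite -[u]mcomp1r -[v]mcomp1r -fg !mcompA uv.
Qed.

Lemma iso_mono X Y (f : phom X Y) : iso f -> mono f.
Proof.
by case=> g [gf _] Z u v uv; rewrite -[u]mcomp1l -[v]mcomp1l -gf -!mcompA uv.
Qed.

Lemma kernel_mono X Y Z (f : phom Y Z) (k : phom X Y) : is_kernel f k -> mono k.
Proof.
move=> [fk0 kU] T u v kuv; have [|w [_ wU]] := kU _ (k ∘ u).
  by rewrite mcompA fk0 comp0m.
by rewrite -(wU u) // -(wU v).
Qed.

Lemma cokernel_epi X Y Z (f : phom X Y) (c : phom Y Z) :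
  is_cokernel f c -> epi c.
Proof.
move=> [cf0 cU] T u v cuv; have [|w [_ wU]] := cU _ (u ∘ c).
  by rewrite -mcompA cf0 compm0.
by rewrite -(wU u) // -(wU v).
Qed.

Lemma kernel_lift X Y Z (f : phom Y Z) (k : phom X Y) T (t : phom T Y) :
  is_kernel f k -> f ∘ t = 0 -> exists u, k ∘ u = t.
Proof. by move=> [_ kU] /kU[u [? _]]; exists u. Qed.

Lemma cokernel_desc X Y Z (f : phom X Y) (c : phom Y Z) T (t : phom Y T) :
  is_cokernel f c -> t ∘ f = 0 -> exists u, u ∘ c = t.
Proof. by move=> [_ kU] /kU[u [? _]]; exists u. Qed.

Lemma cokernel_of_kernel X Y Z K (f : phom X Y) (c : phom Y Z) (k : phom K Y) :
  is_cokernel f c -> is_kernel c k -> is_cokernel k c.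
Proof.
move=> cC kK; have [cf0 cU] := cC; have [ck0 _] := kK.
split=> // T t tk0; have [|u uc] := @cokernel_desc _ _ _ _ _ _ t cC.
  by have [v <-] := kernel_lift kK cf0; rewrite mcompA tk0 comp0m.
by exists u; split=> // v vc; apply: (cokernel_epi cC); rewrite uc vc.
Qed.

Lemma kernel_of_cokernel X Y Z Q (f : phom Y Z) (k : phom X Y) (c : phom Y Q) :
  is_kernel f k -> is_cokernel k c -> is_kernel c k.
Proof.
move=> kK cC; have [fk0 _] := kK; have [ck0 _] := cC.
split=> // T t ct0; have [|u ku] := @kernel_lift _ _ _ _ _ _ t kK.
  by have [v <-] := cokernel_desc cC fk0; rewrite -mcompA ct0 compm0.
by exists u; split=> // v kv; apply: (kernel_mono kK); rewrite ku kv.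
Qed.

End Additivity.

(** * Images and pullbacks in an abelian category *)

Section Abelian.
Variable C : preadditive.
Hypothesis hC : abelian_category C.
Implicit Types X Y Z : C.

Lemma ex_zero : exists O : C, zero_object O.
Proof. by case: hC. Qed.

Lemma ex_zero_subobject (M : C) : exists V : subobject M, sincl V = 0.
Proof.
have [O O0] := ex_zero.
have OM : mono (0 : phom O M).
  by move=> X u v _; rewrite ((O0 X).2 u) ((O0 X).2 v).
by exists (Subobject OM).
Qed.

Lemma ex_biproduct X Y : exists P (i1 : phom X P) (i2 : phom Y P)
  (p1 : phom P X) (p2 : phom P Y), is_biproduct i1 i2 p1 p2.
Proof. by case: hC => _ [+ _]; apply. Qed.

Lemma ex_kernel X Y (f : phom X Y) : exists K (k : phom K X), is_kernel f k.
Proof. by case: hC => _ [_ [+ _]]; apply. Qed.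

Lemma ex_cokernel X Y (f : phom X Y) : exists Q (c : phom Y Q), is_cokernel f c.
Proof. by case: hC => _ [_ [_ [+ _]]]; apply. Qed.

Lemma mono_is_kernel X Y Q (m : phom X Y) (c : phom Y Q) :
  mono m -> is_cokernel m c -> is_kernel c m.
Proof.
move=> mM; case: hC => _ [_ [_ [_ [+ _]]]] => /(_ X Y m mM)[Z [d dm]].
exact: kernel_of_cokernel dm.
Qed.

Lemma epi_is_cokernel X Y K (e : phom X Y) (k : phom K X) :
  epi e -> is_kernel e k -> is_cokernel k e.
Proof.
move=> eE; case: hC => _ [_ [_ [_ [_ +]]]] => /(_ X Y e eE)[Z [d dm]].
by move=> kK; exact: cokernel_of_kernel dm kK.
Qed.

(** The kernel of the cokernel; the work is to see that the first factor is epi. *)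
Lemma ex_image X Y (f : phom X Y) :
  exists I (e : phom X I) (i : phom I Y), [/\ epi e, mono i & f = i ∘ e].
Proof.
have [Q [c cC]] := ex_cokernel f; have [I [i iK]] := ex_kernel c.
have [cf0 _] := cC; have [e ie] := kernel_lift iK cf0.
exists I, e, i; split=> //; last exact: kernel_mono iK.
apply/epi0P => Z u ue0; have [K [k kK]] := ex_kernel u.
have [e1 ke1] := kernel_lift kK ue0.
have ikM : mono (i ∘ k).
  by apply: mono_comp; [exact: kernel_mono iK | exact: kernel_mono kK].
(* [c'] kills [f], hence the whole of the kernel [i] of [coker f] *)
have [Q' [c' c'C]] := ex_cokernel (i ∘ k); have [c'ik0 _] := c'C.
have [|w wc] := @cokernel_desc _ _ _ _ _ _ _ c' cC.
  by rewrite -ie -ke1 2!mcompA -(mcompA c') c'ik0 comp0m.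
have [ci0 _] := iK.
have [|r ikr] := @kernel_lift _ _ _ _ _ _ _ i (mono_is_kernel ikM c'C).
  by rewrite -wc -mcompA ci0 compm0.
have kr1 : k ∘ r = idm I.
  by apply: (kernel_mono iK); rewrite mcompA ikr mcomp1r.
by have [uk0 _] := kK; rewrite -[u]mcomp1r -kr1 mcompA uk0 comp0m.
Qed.

(** The pullback is the kernel of [(f, - g)] on the biproduct. If [f] is epi,
    so is [(f, - g)], which is then the cokernel of that kernel; this is what
    makes the opposite side of the square epi. *)
Lemma ex_pullback X Y Z (f : phom X Z) (g : phom Y Z) :
  exists P (p1 : phom P X) (p2 : phom P Y),
    [/\ f ∘ p1 = g ∘ p2,
        forall T (a : phom T X) (b : phom T Y), f ∘ a = g ∘ b ->
          exists t, p1 ∘ t = a /\ p2 ∘ t = b,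
        mono f -> mono p2 & epi f -> epi p2].
Proof.
have [B [i1 [i2 [q1 [q2 [qi11 qi22 qi12 qi21 iq]]]]]] := ex_biproduct X Y.
have [P [k kK]] := ex_kernel (f ∘ q1 - g ∘ q2); have [fk0 _] := kK.
have sqr : f ∘ (q1 ∘ k) = g ∘ (q2 ∘ k).
  by apply/subr0_eq; rewrite !mcompA -compBm.
exists P, (q1 ∘ k), (q2 ∘ k); split=> //.
- move=> T a b fagb; have [|t kt] := @kernel_lift _ _ _ _ _ _ _ (i1 ∘ a + i2 ∘ b) kK.
    rewrite mcompDr !compBm -!mcompA !(mcompA q1) !(mcompA q2).
    rewrite qi11 qi12 qi21 qi22.
    by rewrite !mcomp1l !comp0m !compm0 subr0 sub0r fagb subrr.
  exists t; rewrite -!mcompA kt !mcompDr !mcompA qi11 qi12 qi21 qi22.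
  by rewrite !mcomp1l !comp0m add0r addr0.
- move=> fM; apply/mono0P => T u q2ku0.
  have q1ku0 : q1 ∘ k ∘ u = 0.
    by move/mono0P: fM; apply; rewrite mcompA sqr -mcompA q2ku0 compm0.
  move/mono0P: (kernel_mono kK); apply.
  by rewrite -[LHS]mcomp1l -iq mcompDl -!mcompA (mcompA q1) (mcompA q2)
    q1ku0 q2ku0 !compm0 addr0.
- move=> fE; apply/epi0P => T u; rewrite mcompA => uq2k0.
  have dE : epi (f ∘ q1 - g ∘ q2).
    apply/epi0P => S v v0; move/epi0P: fE; apply.
    rewrite -[f]mcomp1r -qi11 [f ∘ _]mcompA -(subr0 (f ∘ q1 ∘ i1)) -(compm0 X g).
    by rewrite -qi21 [g ∘ _]mcompA -compBm mcompA v0 comp0m.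
  have [w wd] := cokernel_desc (epi_is_cokernel dE kK) uq2k0.
  have w0 : w = 0.
    move/epi0P: fE; apply; have := congr1 (fun t => t ∘ i1) wd.
    rewrite -!mcompA qi21 compm0 compBm -!mcompA qi11 qi21 compm0 subr0.
    by rewrite mcomp1r.
  by rewrite -[u]mcomp1r -qi22 mcompA -wd w0 !comp0m.
Qed.

End Abelian.

(** * Essential subobjects of a noetherian object *)

(** The ascending chain condition in the form in which it is used below, for
    subobjects, right ideals and annihilators alike. The relation need not be
    antisymmetric, so maximality is stated up to equivalence. *)
Lemma acc_max (T : Type) (le : T -> T -> Prop) (P : T -> Prop) (x0 : T) :
  (forall s : nat -> T, (forall n, le (s n) (s n.+1)) ->
     exists n, forall m, (n <= m)%N -> le (s m) (s n)) ->
  P x0 -> exists x, P x /\ forall y, P y -> le x y -> le y x.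
Proof.
move=> acc Px0; apply: contrapT => nomax.
have step x : exists y, P x -> [/\ P y, le x y & ~ le y x].
  have [Px|?] := EM (P x); last by exists x.
  apply: contrapT => nstep; apply: nomax; exists x; split=> // y Py lexy.
  by apply: contrapT => nle; apply: nstep; exists y.
have [f fP] := choice step.
have Ps n : P (iter n f x0) by elim: n => //= n /fP[].
have [|n nP] := acc (fun n => iter n f x0).
  by move=> n; case: (fP _ (Ps n)).
by case: (fP _ (Ps n)) => _ _; apply; apply: (nP n.+1).
Qed.

Section Essential.
Variable C : preadditive.
Hypothesis hC : abelian_category C.
Implicit Types X Y Z : C.

Lemma biproduct_ext X Y B (i1 : phom X B) (i2 : phom Y B) p1 p2 Z
    (f g : phom Z B) :
  is_biproduct i1 i2 p1 p2 -> p1 ∘ f = p1 ∘ g -> p2 ∘ f = p2 ∘ g -> f = g.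
Proof.
move=> [_ _ _ _ iq] e1 e2; rewrite -[f]mcomp1l -[g]mcomp1l -iq !mcompDl.
by rewrite -!mcompA e1 e2.
Qed.

Lemma copairE X Y B (i1 : phom X B) (i2 : phom Y B) p1 p2 Z
    (f : phom X Z) (g : phom Y Z) : is_biproduct i1 i2 p1 p2 ->
  (f ∘ p1 + g ∘ p2) ∘ i1 = f /\ (f ∘ p1 + g ∘ p2) ∘ i2 = g.
Proof.
move=> [q11 q22 q12 q21 _]; rewrite !mcompDl -!mcompA q11 q22 q12 q21.
by rewrite !compm0 !mcomp1r addr0 add0r.
Qed.

Lemma pairE X Y B (i1 : phom X B) (i2 : phom Y B) p1 p2 Z
    (f : phom Z X) (g : phom Z Y) : is_biproduct i1 i2 p1 p2 ->
  p1 ∘ (i1 ∘ f + i2 ∘ g) = f /\ p2 ∘ (i1 ∘ f + i2 ∘ g) = g.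
Proof.
move=> [q11 q22 q12 q21 _]; rewrite !mcompDr !mcompA q11 q22 q12 q21.
by rewrite !comp0m !mcomp1l addr0 add0r.
Qed.

(** Essentiality tested on arbitrary morphisms instead of subobjects, so that it
    can be used without forming images and intersections. *)
Definition ess V M (v : phom V M) : Prop :=
  forall Y (d : phom Y M), d <> 0 ->
  exists Z (e : phom Z Y) (x : phom Z V), d ∘ e <> 0 /\ v ∘ x = d ∘ e.

Lemma ess_essential M (L : subobject M) : ess (sincl L) -> essential L.
Proof.
move=> eL K D [_ _ Dmax] K0 D0.
have [P [p1 [p2 [sq univ /(_ (@sincl_mono _ _ L)) p2M _]]]] :=
  ex_pullback hC (sincl L) (sincl K).
pose E := Subobject (mono_comp (@sincl_mono _ _ K) p2M).
have [||u Du] := Dmax E; [by exists p1 | by exists p2 |].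
have [Z [e [x [ke0 Lx]]]] :=
  eL _ (sincl K) ((mono_neq0 (@sincl_mono _ _ K)).1 K0).
have [t [_ p2t]] := univ _ _ _ Lx.
have /= u0 : u = 0 by apply: (D0 _).2.
by apply: ke0; rewrite -p2t mcompA -[sincl K ∘ p2]Du u0 compm0 comp0m.
Qed.

Lemma essential_ess M (L : subobject M) : essential L -> ess (sincl L).
Proof.
move=> eL Y d d0; have [I [e [i [eE iM dE]]]] := ex_image hC d.
have I0 : i <> 0 by move=> i0; apply: d0; rewrite dE i0 comp0m.
have [P [p1 [p2 [sq univ /(_ (@sincl_mono _ _ L)) p2M _]]]] :=
  ex_pullback hC (sincl L) i.
have ipM := mono_comp iM p2M.
have /eL D0 : is_intersection L (Subobject iM) (Subobject ipM).
  split; [by exists p1 | by exists p2 |] => /= E [a aE] [b bE] /=.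
  have [|t [_ p2t]] := univ _ a b; first by rewrite aE bE.
  by exists t; rewrite -mcompA p2t.
have /(mono_neq0 ipM) ip0 := D0 ((mono_neq0 iM).2 I0).
have [Z [z1 [z2 [sqz _ _ /(_ eE) z2E]]]] := ex_pullback hC e p2.
have dz1 : d ∘ z1 = i ∘ p2 ∘ z2 by rewrite dE -!mcompA sqz.
exists Z, z1, (p1 ∘ z2); split; last by rewrite mcompA sq -dz1.
by rewrite dz1 => /(epi0P _).1; apply: (fun h => ip0 (h z2E)).
Qed.

(** A test morphism [d] with [f d = 0] factors through the pullback; otherwise
    essentiality of [v] is tested on [f d]. *)
Lemma ess_pullback V M N (v : phom V M) (f : phom N M) P
    (p1 : phom P V) (p2 : phom P N) :
  (forall T (a : phom T V) (b : phom T N), v ∘ a = f ∘ b ->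
     exists t, p1 ∘ t = a /\ p2 ∘ t = b) ->
  ess v -> ess p2.
Proof.
move=> univ ev Y d d0.
have [fd0|fd0] := pselect (f ∘ d = 0).
  have [|t [_ p2t]] := univ _ 0 d; first by rewrite fd0 compm0.
  by exists Y, (idm Y), t; rewrite mcomp1r.
have [Z [e [x [fde0 vx]]]] := ev _ _ fd0.
have [|t [_ p2t]] := univ _ x (d ∘ e); first by rewrite mcompA.
by exists Z, e, t; split=> // de0; apply: fde0; rewrite -mcompA de0 compm0.
Qed.

(** The subobject missed by [v] is the image of a test morphism at which
    essentiality fails; the equation can be tested on the pullback along the
    epimorphism onto this image. *)
Lemma not_ess V M (v : phom V M) : ~ ess v ->
  exists Y (y : phom Y M), [/\ mono y, y <> 0 &
    forall Z (a : phom Z V) (b : phom Z Y), v ∘ a = y ∘ b -> b = 0].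
Proof.
move=> nev; apply: contrapT => nY; apply: nev => Y d d0.
apply: contrapT => nZ; apply: nY.
have [I [e [i [eE iM dE]]]] := ex_image hC d.
exists I, i; split=> //; first by move=> i0; apply: d0; rewrite dE i0 comp0m.
move=> Z a b vaib; have [P [p1 [p2 [sq _ _ /(_ eE) p2E]]]] := ex_pullback hC e b.
have dp1 : d ∘ p1 = v ∘ (a ∘ p2) by rewrite dE -mcompA sq mcompA -vaib mcompA.
apply: (epi0P _).1 p2E _ _ _; apply: (mono0P _).1 iM _ _ _.
rewrite -sq mcompA -dE; apply: contrapT => dp0.
by apply: nZ; exists P, p1, (a ∘ p2).
Qed.

Lemma mono_sum V Y M B (v : phom V M) (y : phom Y M)
    (i1 : phom V B) (i2 : phom Y B) p1 p2 :
  is_biproduct i1 i2 p1 p2 -> mono v -> mono y ->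
  (forall Z (a : phom Z V) (b : phom Z Y), v ∘ a = y ∘ b -> b = 0) ->
  mono (v ∘ p1 + y ∘ p2).
Proof.
move=> hB vM yM ind; apply/mono0P => Z u; rewrite mcompDl -!mcompA => vy0.
have p2u : p2 ∘ u = 0.
  apply: oppr_inj; rewrite oppr0; apply: (ind _ (p1 ∘ u)).
  by apply/eqP; rewrite compmN -addr_eq0; apply/eqP.
apply: (biproduct_ext hB); rewrite compm0 //.
by apply: (mono0P _).1 vM _ _ _; move: vy0; rewrite p2u compm0 addr0.
Qed.

Variable U : C.
Hypothesis hU : noetherian U.

(** The way in which noetherianity produces essential subobjects: a property that
    can be enlarged by a direct summand whenever the subobject [V] misses some
    [Y] holds for some essential subobject. *)
Lemma max_ess_sum (P : subobject U -> Prop) (V0 : subobject U) :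
  P V0 ->
  (forall (V : subobject U) Y (y : phom Y U), P V -> mono y -> y <> 0 ->
     (forall Z (a : phom Z V) (b : phom Z Y), sincl V ∘ a = y ∘ b -> b = 0) ->
     exists Y' (y' : phom Y' Y), [/\ mono y', y' <> 0 &
       forall (W : subobject U) (i1 : phom V W) (i2 : phom Y' W) p1 p2,
         is_biproduct i1 i2 p1 p2 -> sincl W = sincl V ∘ p1 + y ∘ y' ∘ p2 ->
         P W]) ->
  exists V, P V /\ ess (sincl V).
Proof.
move=> PV0 ext; have [V [PV Vmax]] := acc_max hU PV0.
exists V; split=> //; apply: contrapT => /not_ess[Y [y [yM y0 ind]]].
have [Y' [y' [y'M y'0 PW]]] := ext V Y y PV yM y0 ind.
have [B [i1 [i2 [p1 [p2 hB]]]]] := ex_biproduct hC V Y'.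
have ind' Z (a : phom Z V) (b : phom Z Y') : sincl V ∘ a = y ∘ y' ∘ b -> b = 0.
  by rewrite -mcompA => /ind; apply: (mono0P _).1.
have wM := mono_sum hB (@sincl_mono _ _ V) (mono_comp yM y'M) ind'.
have [e1 e2] := copairE (sincl V) (y ∘ y') hB.
have [|/= u uE] := Vmax (Subobject wM) (PW (Subobject wM) _ _ _ _ hB erefl).
  by exists i1.
have i20 : idm Y' = 0.
  by apply: (ind' _ (u ∘ i2)); rewrite mcompA uE e2 mcomp1r.
by apply: y'0; rewrite -[y']mcomp1r i20 compm0.
Qed.

(** A complement of [V], expressed by a retraction onto [V] of an essential
    subobject: the latter is the direct sum of [V] and the complement. *)
Lemma ex_retract (V : subobject U) : exists W (w : phom W U) (a : phom W V) j,
  [/\ mono w, ess w, w ∘ j = sincl V & a ∘ j = idm V].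
Proof.
pose P (W : subobject U) := exists (a : phom W V) j,
  sincl W ∘ j = sincl V /\ a ∘ j = idm V.
have [||W [[a [j [wj aj]]] We]] := @max_ess_sum P V.
- by exists (idm V), (idm V); rewrite mcomp1r mcomp1l.
- move=> W Y y [a [j [wj aj]]] yM y0 _; exists Y, (idm Y); split.
  + exact: mono_id.
  + by move=> Y0; apply: y0; rewrite -[y]mcomp1r Y0 compm0.
  move=> W' i1 i2 p1 p2 hB W'E; exists (a ∘ p1), (i1 ∘ j).
  have [e1 _] := copairE (sincl W) (y ∘ idm Y) hB; have [q11 _ _ _ _] := hB.
  by split; [rewrite W'E mcompA e1 | rewrite -mcompA (mcompA p1) q11 mcomp1l].
by exists W, (sincl W), a, j; split=> //; apply: sincl_mono.
Qed.

(** If [D] is independent of the image of [s], then so are [D], [s D], [s^2 D],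
    and so on. The sums [B_n] of the first [n] of them, with [B_(n+1)] the sum
    of [D] and [s B_n], form an ascending chain. Where it stops, the independence
    allows cancelling [D] and [s] down to [B_1 <= B_0 = 0]. *)
Lemma mono_ess (s : phom U U) : mono s -> ess s.
Proof.
move=> sM; apply: contrapT => /not_ess[D [d [dM d0 ind]]].
have indD B (b : phom B U) Z (a : phom Z D) (x : phom Z B) :
    mono b -> d ∘ a = s ∘ b ∘ x -> x = 0.
  move=> bM dasx; have a0 : a = 0 by apply: (ind _ (b ∘ x)); rewrite mcompA.
  by apply: (mono0P _).1 (mono_comp sM bM) _ _ _; rewrite -dasx a0 compm0.
pose step (B B' : subobject U) := exists (i1 : phom D B') (i2 : phom B B') p1 p2,
  is_biproduct i1 i2 p1 p2 /\ sincl B' = d ∘ p1 + s ∘ sincl B ∘ p2.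
have stepE B : exists B', step B B'.
  have [P [i1 [i2 [p1 [p2 hB]]]]] := ex_biproduct hC D B.
  have bM := @sincl_mono _ _ B.
  have wM := mono_sum hB dM (mono_comp sM bM)
    (fun Z (a : phom Z D) x => @indD _ _ Z a x bM).
  by exists (Subobject wM), i1, i2, p1, p2.
have [F FP] := choice stepE.
have Fmono B B' : sub_le B B' -> sub_le (F B) (F B').
  move=> [u uE]; have [i1 [i2 [p1 [p2 [hB bE]]]]] := FP B.
  have [i1' [i2' [p1' [p2' [hB' bE']]]]] := FP B'.
  exists (i1' ∘ p1 + i2' ∘ (u ∘ p2)).
  have [e1 e2] := pairE p1 (u ∘ p2) hB'.
  by rewrite bE' bE mcompDl -!mcompA e1 e2 (mcompA (sincl B')) uE.
have Frefl B B' : sub_le (F B') (F B) -> sub_le B' B.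
  move=> [u uE]; have [i1 [i2 [p1 [p2 [hB bE]]]]] := FP B.
  have [i1' [i2' [p1' [p2' [hB' bE']]]]] := FP B'.
  exists (p2 ∘ u ∘ i2').
  have [_ e2] := copairE d (s ∘ sincl B') hB'.
  have := congr1 (fun t => t ∘ i2') uE; rewrite bE bE' e2 !mcompDl => sb.
  have p1u0 : p1 ∘ u ∘ i2' = 0.
    apply: (ind _ (sincl B' - sincl B ∘ (p2 ∘ u ∘ i2'))).
    by rewrite compmB -sb !mcompA addrK.
  apply: sM; rewrite -sb -(mcompA d) -(mcompA d) p1u0.
  by rewrite compm0 add0r !mcompA.
have [B0 B00] := ex_zero_subobject hC U; pose S n := iter n F B0.
have Sup n : sub_le (S n) (S n.+1).
  elim: n => [|n IH]; last exact: Fmono.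
  by exists 0; rewrite compm0 B00.
have [n /(_ n.+1 (leqnSn n))] := hU Sup.
elim: n => [|n IH]; last by move=> /Frefl.
move=> [u] /=; rewrite B00 comp0m => F00.
have [i1 [i2 [p1 [p2 [hB bE]]]]] := FP B0.
by apply: d0; have [<- _] := copairE d (s ∘ sincl B0) hB; rewrite -bE -F00 comp0m.
Qed.

End Essential.

(** * Monomorphisms from U to U as denominators *)

Section Torsion.
Variable C : preadditive.
Hypothesis hC : abelian_category C.
Variable U : C.
Hypotheses (hUnoeth : noetherian U) (hUgen : generator U).
Hypotheses (hUns : nonsingular U) (hUec : essentially_compressible U).
Implicit Types M N P V : C.

Definition tors M (h : phom U M) : Prop :=
  exists s : phom U U, mono s /\ h ∘ s = 0.

Lemma gen_neq0 M N (f : phom M N) : f <> 0 -> exists h : phom U M, f ∘ h <> 0.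
Proof. by move=> /hUgen[h fh]; exists h; rewrite comp0m in fh. Qed.

Lemma gen_eq0 M N (f : phom M N) : (forall h : phom U M, f ∘ h = 0) -> f = 0.
Proof. by move=> fh0; apply: contrapT => /gen_neq0[h]; rewrite fh0. Qed.

Lemma compress V (v : phom V U) : mono v -> ess v -> exists t : phom U V, mono t.
Proof.
move=> vM ev; have /hUec[K [f [g [gf fg]]]] : essential (Subobject vM).
  exact: ess_essential.
exists (sincl K ∘ g); apply: mono_comp; first exact: sincl_mono.
exact: iso_mono (iso_inv gf fg).
Qed.

(** The image of [a] is a quotient of [U] by an essential subobject, hence
    singular, and it lies in the nonsingular object [U]. *)
Lemma ann_ess V (v : phom V U) (a : phom U U) : ess v -> a ∘ v = 0 -> a = 0.
Proof.
move=> ev av0; have [I [e [i [eE iM aE]]]] := ex_image hC a.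
have [K [k kK]] := ex_kernel hC e; have kM := kernel_mono kK.
have ev0 : e ∘ v = 0 by apply: (mono0P _).1 iM _ _ _; rewrite mcompA -aE.
have [w kw] := kernel_lift kK ev0.
have ek : ess k.
  move=> Y d /ev[Z [f [x [df0 vx]]]].
  by exists Z, f, (w ∘ x); rewrite mcompA kw.
have /hUns I0 : goldie_weakly_closed (Subobject iM).
  exists U, (Subobject kM), e; split; first exact: ess_essential.
  exact: epi_is_cokernel eE kK.
by rewrite aE [e]((I0 U).2 e) compm0.
Qed.

Lemma mono_ann (s a : phom U U) : mono s -> a ∘ s = 0 -> a = 0.
Proof. by move=> sM; apply/ann_ess/(mono_ess hC hUnoeth sM). Qed.

Lemma ess_pull V M (v : phom V M) (h : phom U M) : mono v -> ess v ->
  exists (s : phom U U) (b : phom U V), mono s /\ h ∘ s = v ∘ b.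
Proof.
move=> vM ev; have [P [p1 [p2 [sq univ /(_ vM) p2M _]]]] := ex_pullback hC v h.
have [t tM] := compress p2M (ess_pullback univ ev).
exists (p2 ∘ t), (p1 ∘ t); split; first exact: mono_comp.
by rewrite !mcompA sq.
Qed.

Lemma ore (s a : phom U U) : mono s ->
  exists s' b : phom U U, mono s' /\ a ∘ s' = s ∘ b.
Proof. by move=> sM; apply: ess_pull sM (mono_ess hC hUnoeth sM). Qed.

(** Take a maximal subobject [V] of [U] over which [p] has a section. If [V]
    missed a nonzero [Y], there would be a nonzero [h : U -> U] which factors
    through [Y] and lifts along [p]. Its kernel is not essential, so [h] is mono
    on a nonzero subobject [Y'] of [U], and the section extends to the image of
    [Y'] under [h]. *)
Lemma section_mod P (p : phom P U) : epi p ->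
  exists (s : phom U U) (t : phom U P), mono s /\ p ∘ t = s.
Proof.
move=> pE; have [V0 V00] := ex_zero_subobject hC U.
pose Q (V : subobject U) := exists v : phom V P, p ∘ v = sincl V.
have [||V [[v pv] ev]] := @max_ess_sum _ hC _ hUnoeth Q V0.
- by exists 0; rewrite compm0 V00.
- move=> V Y y [v pv] yM y0 ind.
  have [R [q1 [q2 [sq _ _ /(_ pE) q2E]]]] := ex_pullback hC p y.
  have [h yqh0] : exists h : phom U R, y ∘ q2 ∘ h <> 0.
    by apply/gen_neq0 => yq0; apply/y0/((epi0P _).1 q2E).
  have [K [k kK]] := ex_kernel hC (y ∘ q2 ∘ h).
  have [|Y' [y' [y'M y'0 ind']]] := @not_ess _ hC _ _ k.
    by move=> /ann_ess/(_ kK.1).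
  have yM' : mono (y ∘ (q2 ∘ h ∘ y')).
    apply/mono0P => Z u; rewrite -mcompA => yu0.
    have [|a ka] := @kernel_lift _ _ _ _ _ _ _ (y' ∘ u) kK.
      by rewrite -!mcompA in yu0 *.
    exact: ind' ka.
  exists Y', (q2 ∘ h ∘ y'); split.
  + exact: mono_compR yM'.
  + move=> q0; apply: y'0; rewrite -[y']mcomp1r.
    suff -> : idm Y' = 0 by rewrite compm0.
    by apply: (mono0P _).1 yM' _ _ _; rewrite q0 compm0 comp0m.
  move=> W i1 i2 p1 p2 hB wE; exists (v ∘ p1 + q1 ∘ h ∘ y' ∘ p2).
  by rewrite mcompDr !mcompA pv sq wE !mcompA.
have [t tM] := compress (@sincl_mono _ _ V) ev.
exists (sincl V ∘ t), (v ∘ t); split; last by rewrite mcompA pv.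
exact: mono_comp (@sincl_mono _ _ V) tM.
Qed.

Lemma lift_mod P N (p : phom P N) (h : phom U N) : epi p ->
  exists (s : phom U U) (t : phom U P), mono s /\ h ∘ s = p ∘ t.
Proof.
move=> pE; have [R [q1 [q2 [sq _ _ /(_ pE) q2E]]]] := ex_pullback hC p h.
have [s [t [sM ts]]] := section_mod q2E.
by exists s, (q1 ∘ t); split=> //; rewrite -ts !mcompA sq.
Qed.

(** For [M = N / L] with [L] essential in [N], lift [h] to [N] up to a
    denominator; the preimage of [L] is then essential in [U]. The extensions
    are handled by multiplying two denominators. *)
Lemma tors_goldie M (h : phom U M) : goldie_localizing M -> tors h.
Proof.
have torsW N (f : phom U N) : goldie_weakly_closed N -> tors f.
  move=> [B [L [q [eL qC]]]].
  have [s [t [sM fs]]] := lift_mod f (cokernel_epi qC).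
  have [s' [b [s'M ts]]] := ess_pull t (@sincl_mono _ _ L) (essential_ess hC eL).
  exists (s ∘ s'); split; first exact: mono_comp.
  by rewrite mcompA fs -mcompA ts mcompA qC.1 comp0m.
move=> [M1 [M2 [f [g [[fK _] W1 W2]]]]].
have [s [sM ghs0]] := torsW _ (g ∘ h) W2.
have [|h' fh'] := @kernel_lift _ _ _ _ _ _ _ (h ∘ s) fK; first by rewrite mcompA.
have [s' [s'M hs0]] := torsW _ h' W1.
exists (s ∘ s'); split; first exact: mono_comp.
by rewrite mcompA -fh' -mcompA hs0 compm0.
Qed.

End Torsion.

(** * Exact direct limits and copowers *)

Section QuotientSystem.
Variables (C : preadditive) (I : small_set) (le : I -> I -> Prop).
Variables (A : C) (D : I -> C) (a : forall i, phom A (D i)).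
Hypotheses (aE : forall i, epi (a i))
  (afac : forall i j, le i j -> exists x, x ∘ a i = a j).

(** Quotients [a i : A -> D i] of a fixed object, ordered by factorization, form
    a direct system: the transition maps are determined by the [a i], since
    these are epi. All direct systems below are of this kind. *)
Definition quot_map i j (p : le i j) : phom (D i) (D j) := projT1 (cid (afac p)).

Lemma quot_mapE i j (p : le i j) : quot_map p ∘ a i = a j.
Proof. exact: projT2 (cid (afac p)). Qed.

Lemma quot_map1 i (p : le i i) : quot_map p = idm (D i).
Proof. by apply: aE; rewrite quot_mapE mcomp1l. Qed.

Lemma quot_mapM i j k (p : le i j) (q : le j k) (r : le i k) :
  quot_map r = quot_map q ∘ quot_map p.
Proof. by apply: aE; rewrite -mcompA !quot_mapE. Qed.

Definition quot_system : direct_system C le :=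
  DirectSystem quot_map1 quot_mapM.

Lemma quot_system_limit L (l : phom A L) (c : forall i, phom (D i) L) :
  directed le -> epi l -> (forall i, c i ∘ a i = l) ->
  (forall X (x : phom A X), (forall i, exists y, y ∘ a i = x) ->
     exists u, u ∘ l = x) ->
  is_direct_limit (D := quot_system) c.
Proof.
move=> [[i0] _ _ leD] lE ca univ; split.
  by move=> i j p; apply: aE; rewrite -mcompA /= quot_mapE !ca.
move=> X d dP; have da i : d i ∘ a i = d i0 ∘ a i0.
  have [k [ik i0k]] := leD i i0.
  by rewrite -(dP _ _ ik) -(dP _ _ i0k) -!mcompA /= !quot_mapE.
have [|u ul] := univ _ (d i0 ∘ a i0); first by move=> i; exists (d i).
exists u; split=> [i|v vc].
  by apply: aE; rewrite -mcompA ca ul da.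
by apply: lE; rewrite ul -vc -mcompA ca.
Qed.

End QuotientSystem.

Section AB5.
Variable C : preadditive.
Hypotheses (hC : abelian_category C) (hAB5 : exact_direct_limits C).
Variable U : C.
Hypothesis hU : noetherian U.

Lemma epi_desc (X Y Z : C) (r : phom X Y) (t : phom X Z) : epi r ->
  (forall T (k : phom T X), r ∘ k = 0 -> t ∘ k = 0) -> exists y, y ∘ r = t.
Proof.
move=> rE tk; have [K [k kK]] := ex_kernel hC r.
exact: cokernel_desc (epi_is_cokernel hC rE kK) (tk _ _ kK.1).
Qed.

(** Let [J i] be the image of [c i ∘ g]. The limits of the systems [D i] and
    [D i / J i] vanish by hypothesis, while [J i] is eventually constant
    because the quotients of [U] satisfy the ascending chain condition on
    kernels. Exactness embeds the limit of the [J i] into zero, so the constant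
    value is zero. *)
Lemma noetherian_small (I : small_set) (le : I -> I -> Prop) (S : C) (D : I -> C)
    (c : forall i, phom S (D i)) (g : phom U S) :
  directed le -> (forall i, epi (c i)) ->
  (forall i j, le i j -> exists x, x ∘ c i = c j) ->
  (forall X (x : phom S X), (forall i, exists y, y ∘ c i = x) -> x = 0) ->
  exists i, c i ∘ g = 0.
Proof.
move=> leD cE cfac c0.
have imE i : exists z : {J : C & (phom U J * phom J (D i))%type},
    [/\ epi (projT2 z).1, mono (projT2 z).2 & c i ∘ g = (projT2 z).2 ∘ (projT2 z).1].
  have [J [e [m [? ? ?]]]] := ex_image hC (c i ∘ g).
  by exists (existT _ J (e, m)).
pose J i := projT1 (projT1 (cid (imE i))).
pose r i : phom U (J i) := (projT2 (projT1 (cid (imE i)))).1.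
pose m i : phom (J i) (D i) := (projT2 (projT1 (cid (imE i)))).2.
have rmE i : [/\ epi (r i), mono (m i) & c i ∘ g = m i ∘ r i].
  exact: projT2 (cid (imE i)).
clearbody J r m.
have rE i : epi (r i) by case: (rmE i).
have mM i : mono (m i) by case: (rmE i).
have cg i : c i ∘ g = m i ∘ r i by case: (rmE i).
have cokE i : exists z : {E : C & phom (D i) E}, is_cokernel (m i) (projT2 z).
  by have [E [d ?]] := ex_cokernel hC (m i); exists (existT _ E d).
pose E i := projT1 (projT1 (cid (cokE i))).
pose d i : phom (D i) (E i) := projT2 (projT1 (cid (cokE i))).
have dC i : is_cokernel (m i) (d i) by exact: projT2 (cid (cokE i)).
clearbody E d.
have dE i := cokernel_epi (dC i).
have rfac i j : le i j -> exists x, x ∘ r i = r j.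
  move=> /cfac[x xc]; apply: epi_desc => // T k rk0.
  apply: (mono0P _).1 (mM j) _ _ _.
  by rewrite mcompA -cg -xc -(mcompA x) cg -!mcompA rk0 !compm0.
have dcE i : epi (d i ∘ c i) by exact: epi_comp.
have dfac i j : le i j -> exists x, x ∘ (d i ∘ c i) = d j ∘ c j.
  move=> /cfac[x xc]; have [|y yd] := @cokernel_desc _ _ _ _ _ _ _ (d j ∘ x) (dC i).
    apply: (epi0P _).1 (rE i) _ _ _; rewrite -!mcompA -cg (mcompA x) xc cg mcompA.
    by rewrite (dC j).1 comp0m.
  by exists y; rewrite mcompA yd -mcompA xc.
have kerE i : exists k : subobject U, is_kernel (r i) (sincl k).
  by have [K [k kK]] := ex_kernel hC (r i); exists (Subobject (kernel_mono kK)).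
have [k kK] := choice kerE.
have kle i j : (exists x, x ∘ r i = r j) -> sub_le (k i) (k j).
  move=> [x xr]; have [|u ku] := @kernel_lift _ _ _ _ _ _ _ (sincl (k i)) (kK j).
    by rewrite -xr -mcompA (kK i).1 compm0.
  by exists u.
have kfac i j : sub_le (k i) (k j) -> exists x, x ∘ r i = r j.
  move=> [u ku]; apply: epi_desc => // T t rt0.
  have [v kv] := kernel_lift (kK i) rt0.
  by rewrite -kv -ku -mcompA mcompA (kK j).1 comp0m.
have [[i0] _ _ leU] := leD.
have [i [_ imax]] := @acc_max I (fun i j => sub_le (k i) (k j)) (fun=> True) i0
  (fun s => hU (s := fun n => k (s n))) Logic.I.
have rmax j : exists x, x ∘ r j = r i.
  have [l [jl il]] := leU j i; apply: kfac.
  have [v vE] := kle _ _ (rfac _ _ jl).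
  have [w wE] := imax l Logic.I (kle _ _ (rfac _ _ il)).
  by exists (w ∘ v); rewrite mcompA wE.
pose q j : phom (J j) (J i) := projT1 (cid (rmax j)).
have qE j : q j ∘ r j = r i by exact: projT2 (cid (rmax j)).
clearbody q.
have [O O0] := ex_zero hC.
have O1 X (x y : phom X O) : x = y by rewrite ((O0 X).2 x) ((O0 X).2 y).
have epiO X : epi (0 : phom X O) by move=> Z u v _; rewrite ((O0 Z).1 u) ((O0 Z).1 v).
have L1 : is_direct_limit (D := quot_system rE rfac) q.
  by apply: (@quot_system_limit _ _ _ _ _ _ rE rfac _ (r i)).
have L2 : is_direct_limit (D := quot_system cE cfac) (fun i => 0 : phom (D i) O).
  apply: (@quot_system_limit _ _ _ _ _ _ cE cfac _ 0) => // X x /c0->.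
  by exists 0; exact: compm0.
have L3 : is_direct_limit (D := quot_system dcE dfac) (fun i => 0 : phom (E i) O).
  apply: (@quot_system_limit _ _ _ _ _ _ dcE dfac _ 0) => // X x xfac;
  exists 0; rewrite compm0; apply/esym/c0 => j.
  by have [y <-] := xfac j; exists (y ∘ d j); rewrite mcompA.
have [|||||/kernel_mono lM _] := 
  @hAB5 I le leD (quot_system rE rfac) (quot_system cE cfac) (quot_system dcE dfac)
    m d _ _ _ _ _ _ _ _ _ L1 L2 L3 0 0 _ _.
- move=> j l p /=; apply: (rE j); rewrite -!mcompA !quot_mapE -!cg.
  by rewrite mcompA quot_mapE.
- by move=> j l p /=; apply: (cE j); rewrite -!mcompA !quot_mapE.
- by move=> j; split=> //; exact: mono_is_kernel.
- by move=> j; exact: O1.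
- by move=> j; exact: O1.
exists i; rewrite cg.
suff -> : r i = 0 by exact: compm0.
by apply: lM; exact: O1.
Qed.

(** Apply [noetherian_small] to the quotients of the copower by its finite
    partial copowers, which are the images of the idempotents [e r]. *)
Lemma copower_finite (I : small_set) (W S : C) (inj : I -> phom W S) :
  is_coproduct inj ->
  exists p : I -> phom S W,
    [/\ forall i, p i ∘ inj i = idm W,
        forall i j, i <> j -> p i ∘ inj j = 0
      & forall g : phom U S, exists r : seq {classic I},
          [/\ uniq r, forall i : {classic I}, i \notin r -> p i ∘ g = 0
            & g = \sum_(i <- r) inj i ∘ (p i ∘ g)]].
Proof.
move=> cop.
have pE (i : {classic I}) : exists p : phom S W,
    forall j : I, p ∘ inj j = if i == j then idm W else 0.
  have [p [pj _]] := cop W (fun j => if i == j then idm W else 0).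
  by exists p.
have [p pP] := choice pE; exists p.
have p1 i : p i ∘ inj i = idm W by rewrite pP eqxx.
have p0 i j : i <> j -> p i ∘ inj j = 0 by move=> /eqP ij; rewrite pP (negPf ij).
have S0 X (x : phom S X) : (forall i, x ∘ inj i = 0) -> x = 0.
  move=> x0; have [u [_ uU]] := cop X (fun=> 0).
  by rewrite -(uU x) // -(uU 0) // => i; rewrite comp0m.
split=> // g.
pose e (r : seq {classic I}) := \sum_(i <- undup r) inj i ∘ p i.
have ej r (j : {classic I}) : j \in r -> e r ∘ inj j = inj j.
  move=> jr; rewrite /e comp_suml (bigD1_seq j) ?mem_undup ?undup_uniq //=.
  rewrite -mcompA p1 mcomp1r big1 ?addr0 // => i ij.
  by rewrite -mcompA p0 ?compm0 //; apply/eqP.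
have ee r r' : {subset r <= r'} -> e r' ∘ e r = e r.
  move=> rr'; rewrite /e comp_sumr; apply: eq_big_seq => i.
  by rewrite mem_undup mcompA => /rr'/ej->.
have cE r : exists z : {Q : C & phom S Q}, is_cokernel (e r) (projT2 z).
  by have [Q [c ?]] := ex_cokernel hC (e r); exists (existT _ Q c).
pose D r := projT1 (projT1 (cid (cE r))).
pose c r : phom S (D r) := projT2 (projT1 (cid (cE r))).
have cC r : is_cokernel (e r) (c r) by exact: projT2 (cid (cE r)).
clearbody D c.
have [||||r cg0] := @noetherian_small (seq {classic I})
  (fun r r' : seq {classic I} => {subset r <= r'}) S D c g.
- split=> //; first exact: (inhabits [::]).
  + by move=> r i.
  + by move=> r r' r'' rr' r'r'' i /rr'/r'r''.
  + move=> r r'; exists (r ++ r').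
    by split=> i ir; rewrite mem_cat ir ?orbT.
- by move=> r; apply: cokernel_epi (cC r).
- move=> r r' /ee er; apply: cokernel_desc (cC r) _.
  by rewrite -er mcompA (cC r').1 comp0m.
- move=> X x xfac; apply: S0 => j; have [y <-] := xfac [:: j].
  by rewrite -(ej [:: j]) ?inE // mcompA -(mcompA y) (cC _).1 compm0 comp0m.
have gE : g = e r ∘ g.
  have [|y yc] := @cokernel_desc _ _ _ _ _ _ _ (idm S - e r) (cC r).
    by rewrite compBm mcomp1l ee ?subrr.
  apply/subr0_eq; rewrite -{1}[g]mcomp1l -compBm -yc -mcompA cg0.
  exact: compm0.
exists (undup r); split; first exact: undup_uniq.
- move=> i; rewrite mem_undup => ir; rewrite gE /e comp_suml comp_sumr.
  apply: big1_seq => j /= ; rewrite mem_undup => jr; rewrite !mcompA p0 ?comp0m //.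
  by move=> ij; rewrite ij jr in ir.
- by rewrite {1}gE /e comp_suml; apply: eq_bigr => i _; rewrite mcompA.
Qed.

End AB5.

(** * The Goldie quotient category *)

Section AdditiveFunctor.
Variables (C D : preadditive) (T : additive_functor C D).

Lemma amap0 X Y : amap T (0 : phom X Y) = 0.
Proof. by apply: (addIr (amap T (0 : phom X Y))); rewrite -amapD !add0r. Qed.

Lemma amapN X Y (f : phom X Y) : amap T (- f) = - amap T f.
Proof. by apply: (addIr (amap T f)); rewrite -amapD !addNr amap0. Qed.

Lemma amapB X Y (f g : phom X Y) : amap T (f - g) = amap T f - amap T g.
Proof. by rewrite amapD amapN. Qed.

Lemma amap_sum X Y (I : Type) (r : seq I) (F : I -> phom X Y) :
  amap T (\sum_(i <- r) F i) = \sum_(i <- r) amap T (F i).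
Proof. by elim/big_rec2: _ => [|i x y _ <-]; rewrite ?amap0 ?amapD. Qed.

End AdditiveFunctor.

Section GoldieClass.
Variable C : preadditive.
Hypothesis hC : abelian_category C.

Lemma goldie_weak_localizing (M : C) :
  goldie_weakly_closed M -> goldie_localizing M.
Proof.
move=> WM; have [O O0] := ex_zero hC.
have OE X (u v : phom X O) : u = v by rewrite ((O0 X).2 u) ((O0 X).2 v).
exists O, M, 0, (idm M); split=> //.
  split; split; rewrite ?mcomp1l ?compm0 // => X t.
    rewrite mcomp1l => ->; exists 0; split; first exact: compm0.
    by move=> *; exact: OE.
  move=> _; exists t; split; first exact: mcomp1r.
  by move=> u; rewrite mcomp1r.
have idO : idm O = 0 by apply: OE.
exists O, (Subobject (@mono_id _ O)), 0; split.
  move=> K D _ []; apply/zero_objectP.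
  by apply: (mono0P _).1 (@sincl_mono _ _ K) _ _ _; exact: OE.
split; first exact: comp0m.
move=> X t _; exists 0; split; first by rewrite ((O0 X).1 t) compm0.
by move=> u _; rewrite ((O0 X).1 u).
Qed.

Lemma ess_goldie (V M Q : C) (v : phom V M) (c : phom M Q) :
  mono v -> ess v -> is_cokernel v c -> goldie_localizing Q.
Proof.
move=> vM ev vc; apply: goldie_weak_localizing.
exists M, (Subobject vM), c; split=> //; exact: ess_essential.
Qed.

End GoldieClass.

Section Quotient.
Variable G : preadditive.
Hypotheses (hG : grothendieck_category G).
Variable U : G.
Hypotheses (hUnoeth : noetherian U) (hUgen : generator U).
Hypotheses (hUns : nonsingular U) (hUec : essentially_compressible U).

Let hC : abelian_category G. Proof. by case: hG. Qed.
Let hcop : has_coproducts G. Proof. by case: hG. Qed.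
Let hAB5 : exact_direct_limits G. Proof. by case: hG. Qed.

Local Notation tors := (tors (U := U)).

(** Write [M] as a quotient of a copower of [U] indexed by Hom (U, M). The kernel
    is essential: a nonzero [g] from [U] to the copower becomes torsion in [M],
    say killed by [s], and [g ∘ s] is nonzero because, by [copower_finite],
    some component of [g] is nonzero and components are not torsion. *)
Lemma goldie_tors (M : G) : (forall h : phom U M, tors h) -> goldie_localizing M.
Proof.
move=> Mt; have [S [inj cop]] := hcop (fun _ : phom U M => U).
have [q [_ _ fin]] := copower_finite hC hAB5 hUnoeth cop.
have [p [pinj _]] := cop M (fun h => h).
have pE : epi p.
  apply/epi0P => X x xp0; apply: (gen_eq0 hUgen) => h.
  by rewrite -(pinj h) mcompA xp0 comp0m.
have [K [k kK]] := ex_kernel hC p.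
apply: (ess_goldie hC (kernel_mono kK) _ (epi_is_cokernel hC pE kK)).
move=> Y d /(gen_neq0 hUgen)[h dh0].
have [s [sM pdhs0]] := Mt (p ∘ (d ∘ h)).
have [|x kx] := @kernel_lift _ _ _ _ _ _ _ (d ∘ h ∘ s) kK.
  by rewrite mcompA.
exists U, (h ∘ s), x; rewrite kx mcompA; split=> // dhs0; apply: dh0.
have [r [_ _ ->]] := fin (d ∘ h); apply: big1 => i _.
suff -> : q i ∘ (d ∘ h) = 0 by exact: compm0.
by apply: (mono_ann hC hUnoeth hUns sM); rewrite -mcompA dhs0 compm0.
Qed.

Variables (Q : preadditive) (T : additive_functor G Q).
Hypothesis hT : is_gabriel_quotient (@goldie_localizing G) T.

Lemma amap_iso_ess V M (v : phom V M) : mono v -> ess v -> iso (amap T v).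
Proof.
move=> vM ev; case: hT => _ + _ _ _; apply; split=> //.
have [R [c cC]] := ex_cokernel hC v.
by exists R, c; split=> //; exact: ess_goldie vM ev cC.
Qed.

Lemma amap_iso (s : phom U U) : mono s -> iso (amap T s).
Proof. by move=> sM; apply: amap_iso_ess => //; exact: mono_ess. Qed.

Lemma amap_cancel (s : phom U U) (X : Q) (f g : phom (T U) X) : mono s ->
  f ∘ amap T s = g ∘ amap T s -> f = g.
Proof. by move=> /amap_iso/iso_epi; apply. Qed.

Lemma mono_mod_refine (V : G) (m : phom V U) :
  mono_mod (@goldie_localizing G) m ->
  exists (s : phom U U) (t : phom U V), mono s /\ s = m ∘ t.
Proof.
move=> [mM [R [c [cC RX]]]].
have [s [sM cs0]] := tors_goldie hC hUnoeth hUgen hUns hUec c RX.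
have [t mt] := kernel_lift (mono_is_kernel hC mM cC) cs0.
by exists s, t.
Qed.

(** A morphism that dies in the quotient dies after a dense restriction and a
    torsion quotient; both are absorbed by denominators. *)
Lemma amap_eq0 M (h : phom U M) : amap T h = 0 <-> tors h.
Proof.
split=> [Th0|[s [sM hs0]]]; last first.
  by apply: (amap_cancel sM); rewrite -amapM hs0 comp0m amap0.
case: hT => _ _ _ _ /(_ _ _ _ Th0)[V [N [m [p [mX [pE [K [k [kK KX]]]] phm0]]]]].
have [s [t [sM st]]] := mono_mod_refine mX.
have [|u ku] := @kernel_lift _ _ _ _ _ _ _ (h ∘ s) kK.
  by rewrite st !mcompA phm0 comp0m.
have [s' [s'M us0]] := tors_goldie hC hUnoeth hUgen hUns hUec u KX.
exists (s ∘ s'); split; first exact: mono_comp.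
by rewrite mcompA -ku -mcompA us0 compm0.
Qed.

(** The denominator comes from the restriction [m] and from lifting the numerator
    along [p], up to a further denominator. *)
Lemma fraction M (f : phom (T U) (T M)) :
  exists (s : phom U U) (h : phom U M), mono s /\ f ∘ amap T s = amap T h.
Proof.
have [_ _ isoE + _] := hT.
move=> /(_ _ _ f)[V [N [m [p [g [mX pX pfm]]]]]].
have [s [t [sM st]]] := mono_mod_refine mX.
have [s' [h [s'M gh]]] := lift_mod hC hUnoeth hUgen hUns hUec (g ∘ t) pX.1.
exists (s ∘ s'), h; split; first exact: mono_comp.
apply: (iso_mono (isoE _ _ _ pX)); rewrite -amapM -gh !amapM -pfm.
by rewrite st amapM !mcompA.
Qed.

Lemma goldie_amap0 M : goldie_localizing M -> amap T (idm M) = 0.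
Proof.
move=> MX; have [O O0] := ex_zero hC.
have pX : epi_mod (@goldie_localizing G) (0 : phom M O).
  split; first by move=> X u v _; rewrite ((O0 X).1 u) ((O0 X).1 v).
  exists M, (idm M); split=> //; split; first exact: comp0m.
  move=> X t _; exists t; split; first exact: mcomp1l.
  by move=> u; rewrite mcomp1l.
have [_ _ /(_ _ _ _ pX)[z [z0 _]] _ _] := hT.
by rewrite amap1 -z0 amap0 compm0.
Qed.

Lemma hom_faithful M N (f : phom (T M) (T N)) :
  (forall h : phom U M, f ∘ amap T h = 0) -> f = 0.
Proof.
move=> fh0; have [_ isoM isoE full _] := hT.
have [V [R [m [p [g [mX pX pfm]]]]]] := full _ _ f.
suff g0 : amap T g = 0.
  apply: (iso_epi (isoM _ _ _ mX)); apply: (iso_mono (isoE _ _ _ pX)).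
  by rewrite mcompA pfm g0 comp0m compm0.
have [I [e [i [eE iM gE]]]] := ex_image hC g.
have IX : goldie_localizing I.
  apply: goldie_tors => h.
  have [s [t [sM hs]]] := lift_mod hC hUnoeth hUgen hUns hUec h eE.
  have /amap_eq0[s' [s'M gts0]] : amap T (g ∘ t) = 0.
    by rewrite amapM -pfm -mcompA -mcompA -amapM fh0 compm0.
  exists (s ∘ s'); split; first exact: mono_comp.
  by apply: (mono0P _).1 iM _ _ _; rewrite (mcompA h) hs !mcompA -gE.
by rewrite gE -[i]mcomp1r -mcompA !amapM goldie_amap0 // comp0m compm0.
Qed.

(** Choose fractions [a (T h) = T f_h (T s_h)^-1] for all [h : U -> M]. On the
    copower [S] of [U] indexed by the [h], let [p : S -> M] have components
    [h s_h], and let [f : S -> N] have components [f_h]. Linearity of [a] makes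
    the image of the kernel of [p] under [f] torsion, so modulo torsion [f]
    descends to the image of [p], which is dense in [M]. *)
Lemma hom_full M N (a : phom (T U) (T M) -> phom (T U) (T N)) :
  (forall f g, a (f + g) = a f + a g) ->
  (forall f (e : phom (T U) (T U)), a (f ∘ e) = a f ∘ e) ->
  exists f, forall g, a g = f ∘ g.
Proof.
move=> aD aM.
have a0 : a 0 = 0 by apply: (addIr (a 0)); rewrite -aD !add0r.
have a_sum (I : Type) (r : seq I) F :
    a (\sum_(i <- r) F i) = \sum_(i <- r) a (F i).
  by elim/big_rec2: _ => [|i x y _ <-]; rewrite ?a0 ?aD.
have frac (h : phom U M) : exists z : phom U U * phom U N,
    mono z.1 /\ a (amap T h) ∘ amap T z.1 = amap T z.2.
  by have [s [g ?]] := fraction (a (amap T h)); exists (s, g).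
have [z zP] := choice frac.
have [S [inj cop]] := hcop (fun _ : phom U M => U).
have [q [_ _ fin]] := copower_finite hC hAB5 hUnoeth cop.
have [p [pinj _]] := cop M (fun h => h ∘ (z h).1).
have [f [finj _]] := cop N (fun h => (z h).2).
have [K [k kK]] := ex_kernel hC p.
have fk_tors (u : phom U K) : tors (f ∘ k ∘ u).
  apply/amap_eq0; have [r [_ _ kuE]] := fin (k ∘ u).
  have pku : p ∘ (k ∘ u) = 0 by rewrite mcompA kK.1 comp0m.
  rewrite -mcompA; move: (k ∘ u) kuE pku => w wE pw0.
  transitivity (a (amap T (p ∘ w))); last by rewrite pw0 amap0.
  have -> : p ∘ w = \sum_(h <- r) p ∘ (inj h ∘ (q h ∘ w)).
    by rewrite {1}wE comp_sumr.
  rewrite {1}wE comp_sumr !amap_sum a_sum; apply: eq_bigr => h _.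
  by rewrite !(mcompA _ (inj h)) pinj finj !amapM !aM (zP h).2.
have [B [e [m [eE mM fkE]]]] := ex_image hC (f ∘ k).
have BX : goldie_localizing B.
  apply: goldie_tors => h.
  have [s [t [sM hs]]] := lift_mod hC hUnoeth hUgen hUns hUec h eE.
  have [s' [s'M fkts0]] := fk_tors t.
  exists (s ∘ s'); split; first exact: mono_comp.
  by apply: (mono0P _).1 mM _ _ _; rewrite (mcompA h) hs !mcompA -fkE.
have [R [c cC]] := ex_cokernel hC m.
have cX : epi_mod (@goldie_localizing G) c.
  split; first exact: cokernel_epi cC.
  by exists B, m; split=> //; exact: mono_is_kernel.
have [M0 [e0 [m0 [e0E m0M pE]]]] := ex_image hC p.
have [g ge0] : exists g, g ∘ e0 = c ∘ f.
  apply: (epi_desc hC) => // X t e0t0.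
  have [|u <-] := @kernel_lift _ _ _ _ _ _ _ t kK.
    by rewrite pE -mcompA e0t0 compm0.
  by rewrite mcompA -(mcompA c) fkE mcompA cC.1 !comp0m.
have m0X : mono_mod (@goldie_localizing G) m0.
  split=> //; have [R0 [c0 c0C]] := ex_cokernel hC m0; exists R0, c0; split=> //.
  apply: goldie_tors => h.
  have [s [t [sM hs]]] :=
    lift_mod hC hUnoeth hUgen hUns hUec h (cokernel_epi c0C).
  exists (s ∘ (z t).1); split; first by apply: mono_comp => //; exact: (zP t).1.
  by rewrite mcompA hs -mcompA -pinj pE -mcompA mcompA c0C.1 comp0m.
have [_ isoM isoE _ _] := hT.
have [c' [c'c _]] := isoE _ _ _ cX; have [m' [m'm _]] := isoM _ _ _ m0X.
(* The candidate [(T c)^-1 T g (T m0)^-1] is correct on the [T h]. *)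
have phiE h : c' ∘ amap T g ∘ m' ∘ amap T h = a (amap T h).
  have hE : h ∘ (z h).1 = m0 ∘ (e0 ∘ inj h) by rewrite -pinj pE mcompA.
  apply: (amap_cancel (zP h).1); rewrite (zP h).2 -mcompA -amapM hE amapM.
  rewrite (mcompA _ (amap T m0)) -(mcompA _ m') m'm mcomp1r -mcompA -amapM.
  by rewrite mcompA ge0 -mcompA finj amapM mcompA c'c mcomp1l.
exists (c' ∘ amap T g ∘ m') => f0; have [s [h [sM f0s]]] := fraction f0.
by apply: (amap_cancel sM); rewrite -aM -mcompA f0s phiE.
Qed.

End Quotient.

(** * Rings whose right ideals are generated by idempotents *)

(** The element [e] is an idempotent generating [I], since [e * e = e]. *)
Definition idempotent_ideals (R : pzRingType) : Prop :=
  forall I : R -> Prop, right_ideal I -> exists e, I e /\ forall x, I x -> e * x = x.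

Section IdempotentIdeals.
Variable R : pzRingType.
Hypothesis hR : idempotent_ideals R.
Implicit Types I J : R -> Prop.

Lemma right_idealB I x y : right_ideal I -> I x -> I y -> I (x - y).
Proof. by move=> [_ ID IM] Ix Iy; apply: ID => //; rewrite -mulrN1; apply: IM. Qed.

(** The generator of the union already lies in one of the ideals. *)
Lemma right_ideal_acc (I : nat -> R -> Prop) :
  (forall n, right_ideal (I n)) -> (forall n x, I n x -> I n.+1 x) ->
  exists n, forall m x, I m x -> I n x.
Proof.
move=> II Iup.
have Imono n m : (n <= m)%N -> forall x, I n x -> I m x.
  by move=> /subnK <-; elim: (m - n)%N => //= k IH x /IH/Iup.
have [|e [[n Ie] eI]] := hR (I := fun x => exists n, I n x).
  split=> [|x y [n Ix] [m Iy]|x r [n Ix]].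
  - by exists 0%N; case: (II 0%N).
  - exists (maxn n m); case: (II (maxn n m)) => _ ID _; apply: ID.
      exact: Imono (leq_maxl n m) _ Ix.
    exact: Imono (leq_maxr n m) _ Iy.
  - by exists n; case: (II n) => _ _; apply.
exists n => m x Ix; rewrite -(eI x); last by exists m.
by case: (II n) => _ _; apply.
Qed.

(** The descending condition is the ascending one for complements. *)
Lemma idempotent_right_artinian : right_artinian R.
Proof.
move=> I II Idown.
have [e eP] := choice (fun n => hR (II n)).
have eI n : I n (e n) by case: (eP n).
have eK n x : I n x -> e n * x = x by case: (eP n) => _; apply.
(* [K n] is a complement of [I n] in [I 0], built by adding up complements
   of [I k.+1] in [I k]. *)
pose fix K n : R -> Prop := if n is n'.+1 then
    fun x => exists c d, [/\ K n' c, I n' d, e n'.+1 * d = 0 & x = c + d]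
  else fun x => x = 0.
have KI n : right_ideal (K n).
  elim: n => [|n [K0 KD KM]] /=.
    by split=> [//|x y -> ->|x r ->]; rewrite ?addr0 ?mul0r.
  have [I0 ID IM] := II n; split.
  - by exists 0, 0; rewrite mulr0 addr0.
  - move=> x y [c [d [Kc Id ed ->]]] [c' [d' [Kc' Id' ed' ->]]].
    exists (c + c'), (d + d'); rewrite mulrDr ed ed' addr0 addrACA.
    by split=> //; [apply: KD | apply: ID].
  - move=> x r [c [d [Kc Id ed ->]]]; exists (c * r), (d * r).
    by rewrite mulrDl mulrA ed mul0r; split=> //; [apply: KM | apply: IM].
have Kup n x : K n x -> K n.+1 x.
  move=> Kx; exists x, 0; rewrite mulr0 addr0; split=> //.
  by case: (II n).
have KI0 n x : K n x -> I n x -> x = 0.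
  elim: n x => [//|n IH] x [c [d [Kc Id ed ->]]] Icd.
  have c0 : c = 0.
    apply: IH => //; rewrite -[c](addrK d); apply: right_idealB (II n) _ Id.
    exact: Idown.
  by move: Icd; rewrite c0 add0r => /eK <-.
have [n nP] := right_ideal_acc KI Kup.
have Kmono m : (n <= m)%N -> forall x, K n x -> K m x.
  by move=> /subnK <-; elim: (m - n)%N => //= k IH x /IH/Kup.
exists n => m /subnK <-; elim: (m - n)%N => //= k IH x /IH Ix.
have Iex : I (k + n)%N (e (k + n).+1 * x).
  by apply: Idown; case: (II (k + n).+1) => _ _; apply.
have Id := right_idealB (II _) Ix Iex.
have Kd : K (k + n).+1 (x - e (k + n).+1 * x).
  exists 0, (x - e (k + n).+1 * x); split; rewrite ?add0r //.
    by case: (KI (k + n)%N).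
  by rewrite mulrBr mulrA (eK _ _ (eI _)) subrr.
have /subr0_eq -> := KI0 _ _ (Kmono _ (leq_addl k n) _ (nP _ _ Kd)) Id.
by case: (II (k + n).+1) => _ _; apply.
Qed.

Lemma von_neumann_regular (x : R) : exists y, x * y * x = x.
Proof.
have [|e [[y ->] ex]] := hR (I := fun z => exists y, z = x * y).
  split=> [|_ _ [y ->] [z ->]|_ r [y ->]].
  - by exists 0; rewrite mulr0.
  - by exists (y + z); rewrite mulrDr.
  - by exists (y * r); rewrite mulrA.
by exists y; apply: ex; exists 1; rewrite mulr1.
Qed.

(** In a left ideal [L] take [x] with minimal right annihilator, and replace it
    by an idempotent [f] with the same annihilator, using [x y x = x]. If [L]
    were not generated by [f], some nonzero idempotent [g] in [L] would satisfy
    [g f = 0], and [f + (1 - f) g] would have a strictly smaller annihilator. *)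
Lemma idempotent_ideals_converse : idempotent_ideals R^c.
Proof.
move=> L [L0 LD LM].
have {}LM (r x : R) : L x -> L (r * x) by move=> Lx; apply: (LM x r).
have {}LD (x y : R) : L x -> L y -> L (x + y) by exact: LD.
have LB (x y : R) : L x -> L y -> L (x - y).
  by move=> Lx Ly; apply: LD => //; rewrite -mulN1r; apply: LM.
pose ann (x : R) (r : R) := x * r = 0.
have annI x : right_ideal (ann x).
  split=> [|r s rx sx|r s rx]; rewrite /ann ?mulr0 //.
    by rewrite mulrDr rx sx addr0.
  by rewrite mulrA rx mul0r.
have [x [Lx xmax]] : exists x : R, L x /\ forall y : R, L y ->
    (forall r, ann y r -> ann x r) -> forall r, ann x r -> ann y r.
  apply: (@acc_max R (fun x y => forall r, ann y r -> ann x r) L 0 _ L0) => s sup.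
  exact: idempotent_right_artinian.
have [y xyx] := von_neumann_regular x; pose f := y * x.
have Lf : L f by exact: LM.
have xf : x * f = x by rewrite /f mulrA xyx.
have ff : f * f = f by rewrite {1}/f -mulrA xf.
suff zf (z : R) : L z -> z * f = z by exists f; split=> // z /zf.
move=> Lz; apply/esym/subr0_eq; set w := z - z * f.
have Lw : L w by apply: LB => //; exact: LM.
have wf : w * f = 0 by rewrite mulrBl -mulrA ff subrr.
have [v wvw] := von_neumann_regular w; pose g := v * w.
have gf : g * f = 0 by rewrite -mulrA wf mulr0.
have Lg : L g by exact: LM.
have gg : g * g = g by rewrite /g -mulrA (mulrA w) wvw.
(* [x] and [x'] have the same annihilator, so [1 - f] kills [x']. *)
pose x' := f + (g - f * g).
have x'ann : ann x' (1 - f).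
  apply: xmax; first by apply: LD => //; apply: LB => //; exact: LM.
    move=> r x'r; have : f * (x' * r) = 0 by rewrite x'r mulr0.
    rewrite mulrA mulrDr mulrBr mulrA ff subrr addr0 => fr0.
    by rewrite /ann -xf -mulrA fr0 mulr0.
  by rewrite /ann mulrBr mulr1 xf subrr.
have : g - f * g = 0.
  move: x'ann; rewrite /ann mulrDl !mulrBr !mulr1 ff subrr add0r.
  by rewrite mulrBl -(mulrA f g f) gf mulr0 !subr0.
move=> /subr0_eq gfg.
have g0 : g = 0 by rewrite -gg {2}gfg mulrA gf mul0r.
by rewrite -wvw -mulrA -/g g0 mulr0.
Qed.

Lemma ex_simple J x : right_ideal J -> J x -> x <> 0 ->
  exists I, simple_right_ideal I /\ forall y, I y -> J y.
Proof.
move=> JI Jx x0.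
pose le (A B : {I : R -> Prop | right_ideal I}) := forall y, sval B y -> sval A y.
pose P (A : {I | right_ideal I}) :=
  (forall y, sval A y -> J y) /\ exists y, sval A y /\ y <> 0.
have [||[I II] [[IJ I0] Imin]] := @acc_max _ le P (exist _ J JI).
- move=> s; apply: idempotent_right_artinian => n; exact: (svalP (s n)).
- by split=> //; exists x.
exists I; split=> //; split=> // K KI KsubI.
have [[y [Ky y0]]|nK] := pselect (exists y, K y /\ y <> 0).
  right; apply: (Imin (exist _ K KI)) => //; split; last by exists y.
  by move=> z /KsubI/IJ.
by left=> y Ky; apply: contrapT => y0; apply: nK; exists y.
Qed.

(** The socle is a right ideal, so it is generated by an idempotent [e]. If it is
    not everything, the right annihilator of [e] is nonzero and contains a simple
    right ideal, which lies in the socle and is therefore fixed by [e]. *)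
Lemma idempotent_semisimple : semisimple R.
Proof.
pose S (x : R) := exists (n : nat) (I : 'I_n -> R -> Prop) (y : 'I_n -> R),
    (forall i, simple_right_ideal (I i) /\ I i (y i)) /\ x = \sum_(i < n) y i.
have SI : right_ideal S.
  split.
  - by exists 0%N, (fun _ _ => True), (fun=> 0); rewrite big_ord0; split=> // -[].
  - move=> _ _ [n [I [y [Iy ->]]]] [m [K [z [Kz ->]]]].
    exists (n + m)%N.
    exists (fun k => match split k with inl i => I i | inr j => K j end).
    exists (fun k => match split k with inl i => y i | inr j => z j end); split.
      by move=> k; case: (split k).
    rewrite big_split_ord; congr (_ + _); apply: eq_bigr => i _.
      by rewrite (unsplitK (inl i)).
    by rewrite (unsplitK (inr i)).
  - move=> _ r [n [I [y [Iy ->]]]]; exists n, I, (fun i => y i * r).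
    rewrite mulr_suml; split=> // i; have [II Iyi] := Iy i; split=> //.
    by case: II => -[_ _ IM] _ _; exact: IM.
have [e [Se eS]] := hR SI.
move=> x; change (S x); apply: contrapT => nSx.
have d0 : x - e * x <> 0.
  move=> /subr0_eq xE; apply: nSx; rewrite xE.
  by case: SI => _ _; apply.
have [|||I [Isimple Ie]] := @ex_simple (fun y => e * y = 0) (x - e * x) => //.
- split=> [|y z ey ez|y r ey]; rewrite ?mulr0 // ?mulrDr ?ey ?ez ?addr0 //.
  by rewrite mulrA ey mul0r.
- by rewrite mulrBr mulrA (eS e) // subrr.
have [_ [y [Iy y0]] _] := Isimple.
apply: y0; rewrite -(eS y) ?Ie //.
by exists 1%N, (fun=> I), (fun=> y); rewrite big_ord1.
Qed.

End IdempotentIdeals.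

Lemma idempotent_semisimple_artinian (R : pzRingType) :
  idempotent_ideals R -> semisimple_artinian R.
Proof.
move=> hR; split; first exact: idempotent_semisimple.
split; apply: idempotent_right_artinian => //.
exact: idempotent_ideals_converse.
Qed.

(** * Equivalences with module categories *)

Section Equivalence.
Variables (C D : category) (F : functor C D).

Lemma equivalence_of_fully_faithful :
  (forall X Y, injective (@fmap C D F X Y)) ->
  (forall X Y (g : chom (F X) (F Y)), exists f, fmap F f = g) ->
  (forall Z : D, exists X (f : chom (F X) Z) (g : chom Z (F X)),
     ccomp g f = Defs.cid (F X) /\ ccomp f g = Defs.cid Z) ->
  is_equivalence F.
Proof.
move=> Finj Ffull Fsurj.
have obE (Z : D) : exists w : {X : C & (chom (F X) Z * chom Z (F X))%type},
    ccomp (projT2 w).2 (projT2 w).1 = Defs.cid (F (projT1 w)) /\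
    ccomp (projT2 w).1 (projT2 w).2 = Defs.cid Z.
  by have [X [f [g ?]]] := Fsurj Z; exists (existT _ X (f, g)).
pose ob Z : C := projT1 (projT1 (cid (obE Z))).
pose p Z : chom (F (ob Z)) Z := (projT2 (projT1 (cid (obE Z)))).1.
pose q Z : chom Z (F (ob Z)) := (projT2 (projT1 (cid (obE Z)))).2.
have qp Z : ccomp (q Z) (p Z) = Defs.cid _ by case: (projT2 (cid (obE Z))).
have pq Z : ccomp (p Z) (q Z) = Defs.cid _ by case: (projT2 (cid (obE Z))).
clearbody ob p q.
pose lift X Y (g : chom (F X) (F Y)) := projT1 (cid (Ffull X Y g)).
have liftE X Y (g : chom (F X) (F Y)) : fmap F (lift X Y g) = g.
  exact: projT2 (cid (Ffull X Y g)).
clearbody lift.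
have G1 Z : lift _ _ (ccomp (q Z) (ccomp (Defs.cid Z) (p Z))) = Defs.cid (ob Z).
  by apply: Finj; rewrite liftE ccomp1m qp fmap1.
have GM X Y Z (g : chom Y Z) (f : chom X Y) :
    lift _ _ (ccomp (q Z) (ccomp (ccomp g f) (p X))) =
    ccomp (lift _ _ (ccomp (q Z) (ccomp g (p Y))))
          (lift _ _ (ccomp (q Y) (ccomp f (p X)))).
  apply: Finj; rewrite fmapM !liftE -!ccompA (ccompA (p Y)) pq ccomp1m.
  by rewrite !ccompA.
exists (@Functor D C ob _ G1 GM); split.
  exists (fun X => lift _ _ (p (F X))), (fun X => lift _ _ (q (F X))); split.
  - move=> X Y f; apply: Finj; rewrite /= !fmapM !liftE.
    by rewrite ccompA pq ccomp1m.
  - by move=> X; apply: Finj; rewrite fmapM !liftE /= qp fmap1.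
  - by move=> X; apply: Finj; rewrite fmapM !liftE /= pq fmap1.
exists p, q; split=> [X Y f|X|X] //=; by rewrite liftE ccompA pq ccomp1m.
Qed.

End Equivalence.

Lemma linear_bijective_iso (R : pzRingType) (A B : lmodType R^c)
    (b : A -> B) : linear b -> bijective b ->
  exists (f : chom (A : Mod R) B) (g : chom (B : Mod R) A),
    ccomp g f = Defs.cid (A : Mod R) /\ ccomp f g = Defs.cid (B : Mod R).
Proof.
move=> b_lin [g bK gK].
have g_lin : linear g.
  by move=> a x y; apply: (can_inj bK); rewrite b_lin !gK.
pose bM := GRing.isLinear.Build _ _ _ _ b b_lin.
pose gM := GRing.isLinear.Build _ _ _ _ g g_lin.
pose bl : {linear A -> B} := HB.pack b bM.
pose gl : {linear B -> A} := HB.pack g gM.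
by exists bl, gl; split; apply: linear_map_eq; apply: funext => x /=.
Qed.

(** Makes a sum over a finite support independent of the list that enumerates a
    set containing the support. *)
Lemma sum_support (V : nmodType) (I : eqType) (F : I -> V) (r r' : seq I) :
  uniq r -> uniq r' -> (forall i, i \notin r -> F i = 0) ->
  (forall i, i \notin r' -> F i = 0) -> \sum_(i <- r) F i = \sum_(i <- r') F i.
Proof.
move=> ru ru' r0 r0'.
have restrict (s s' : seq I) : (forall i, i \notin s' -> F i = 0) ->
    \sum_(i <- s) F i = \sum_(i <- [seq i <- s | i \in s']) F i.
  move=> s0; rewrite big_filter (bigID (mem s')) /= [X in _ + X]big1 ?addr0 //.
rewrite (restrict r r') // (restrict r' r) //; apply: perm_big.
apply: uniq_perm; rewrite ?filter_uniq // => i.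
by rewrite !mem_filter andbC.
Qed.

(** * The endomorphism ring of U in the Goldie quotient *)

Section GoldieQuotientRing.
Variable G : preadditive.
Hypotheses (hG : grothendieck_category G).
Variable U : G.
Hypotheses (hUnoeth : noetherian U) (hUgen : generator U).
Hypotheses (hUns : nonsingular U) (hUec : essentially_compressible U).
Variables (Q : preadditive) (T : additive_functor G Q).
Hypothesis hT : is_gabriel_quotient (@goldie_localizing G) T.

Let hC : abelian_category G. Proof. by case: hG. Qed.
Let hcop : has_coproducts G. Proof. by case: hG. Qed.
Let hAB5 : exact_direct_limits G. Proof. by case: hG. Qed.

Let Tcancel := amap_cancel hG hUnoeth hT.
Let Tiso := amap_iso hG hUnoeth hT.
Let frac := fraction hG hUnoeth hUgen hUns hUec hT.
Let lift := lift_mod hC hUnoeth hUgen hUns hUec.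
Let T0 := amap_eq0 hG hUnoeth hUgen hUns hUec hT.

Lemma regular_mono (a : endo U) : regular a -> mono (a : phom U U).
Proof.
move=> areg; apply/mono0P => Z u au0; apply: (gen_eq0 hUgen) => h.
have auh0 : (a : phom U U) ∘ (u ∘ h) = 0 by rewrite mcompA au0 comp0m.
by apply: contrapT => /(areg (u ∘ h))[].
Qed.

Lemma mono_regular (s : endo U) : mono (s : phom U U) -> regular s.
Proof.
move=> sM b b0; split=> e0; apply: b0.
  exact: (mono0P _).1 sM _ _ e0.
exact: (mono_ann hC hUnoeth hUns sM e0).
Qed.

Lemma endo_classical_quotient :
  is_classical_right_quotient_ring (endo_map T : {rmorphism endo U -> endo (T U)}).
Proof.
split.
- move=> f g Tfg; apply/subr0_eq.
  have /T0[s [sM fgs0]] : amap T ((f : phom U U) - g) = 0.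
    by rewrite amapB; apply/eqP; rewrite subr_eq0; apply/eqP; exact: Tfg.
  exact: (mono_ann hC hUnoeth hUns sM fgs0).
- by move=> a /regular_mono/Tiso[b [ba ab]]; exists b.
- move=> q; have [s [h [sM qs]]] := frac q; have [t [ts st]] := Tiso sM.
  exists h, s, t; split; [exact: mono_regular | by [] |].
  have qE : (q : phom _ _) = amap T h ∘ t by rewrite -qs -mcompA st mcomp1r.
  exact: qE.
Qed.

(** The right ideal [J] consists of the fractions [T (v h') (T s)^-1], where [v]
    is the inclusion of the subobject [V] below. If [w : W -> U] is essential
    with a retraction [a : W -> V] and [w t] is a denominator, then the fraction
    [T (v a t) (T (w t))^-1] is a projection onto [V], that is, a left identity
    on [J]. *)
Lemma endo_idempotent_ideals : idempotent_ideals (endo (T U)).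
Proof.
move=> J [J0 JD JM].
have JM' (f e : phom (T U) (T U)) : J f -> J (f ∘ e) by move=> Jf; exact: JM.
have Jcancel (f : phom (T U) (T U)) (s : phom U U) :
    mono s -> J (f ∘ amap T s) -> J f.
  move=> /Tiso[t [_ st]] Jfs.
  by rewrite -[f]mcomp1r -st mcompA; exact: JM'.
have [V0 V00] := ex_zero_subobject hC U.
pose P (V : subobject U) := forall g : phom U V, J (amap T (sincl V ∘ g)).
have [|V [PV Vmax]] := @acc_max _ _ P V0 hUnoeth.
  by move=> g; rewrite V00 comp0m amap0.
(* Maximality of [V]: numerators of elements of [J] factor through [V]. *)
have Vfac (f : phom U U) : J (amap T f) -> exists f', f = sincl V ∘ f'.
  move=> JTf; have [B [i1 [i2 [p1 [p2 hB]]]]] := ex_biproduct hC V U.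
  have [w1 w2] := copairE (sincl V) f hB.
  have [I [e [i [eE iM wE]]]] := ex_image hC (sincl V ∘ p1 + f ∘ p2).
  have [||u /= vu] := Vmax (Subobject iM).
  - move=> g; have [s [t [sM gs]]] := lift g eE.
    apply: (Jcancel _ s) => //; rewrite /= -amapM -mcompA gs mcompA -wE mcompDl amapD.
    apply: JD; first by rewrite -mcompA; exact: PV.
    by rewrite -mcompA amapM; exact: JM'.
  - by exists (e ∘ i1); rewrite mcompA -wE.
  by exists (u ∘ (e ∘ i2)); rewrite mcompA vu mcompA -wE w2.
have [W [w [a [j [wM we wj aj]]]]] := ex_retract hC hUnoeth V.
have [t tM] := compress hC hUec wM we.
have sM := mono_comp wM tM; have [r [rs sr]] := Tiso sM.
exists (amap T (sincl V ∘ (a ∘ t)) ∘ r); split; first exact/JM'/PV.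
suff er (f : phom (T U) (T U)) :
    J f -> amap T (sincl V ∘ (a ∘ t)) ∘ r ∘ f = f by exact: er.
move=> Jf; have [s1 [h [s1M fs1]]] := frac f.
have [|h' hE] := Vfac h; first by rewrite -fs1; exact: JM'.
have [s2 [b [s2M hs2]]] := ore hC hUnoeth hUec h sM.
have ath : a ∘ t ∘ b = h' ∘ s2.
  rewrite -[RHS]mcomp1l -aj -!mcompA; congr (_ ∘ _); apply: wM.
  by rewrite !mcompA wj -hE hs2.
apply: (Tcancel (mono_comp s1M s2M)).
have fsE : f ∘ amap T (s1 ∘ s2) = amap T (w ∘ t) ∘ amap T b.
  by rewrite amapM mcompA fs1 -amapM hs2 amapM.
rewrite -(mcompA _ f) fsE (mcompA _ (amap T (w ∘ t))) -(mcompA _ r) rs mcomp1r.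
by rewrite -!amapM -hs2 hE -!mcompA (mcompA a) ath.
Qed.

Lemma quotient_ind (P : Q -> Prop) : (forall M, P (T M)) -> forall X, P X.
Proof. by move=> PT X; case: hT => -[g _ gK] _ _ _ _; rewrite -(gK X). Qed.

(** Let [S] be the copower of [U] indexed by the elements of [A]. A morphism
    [u : U -> S] has finitely many components [u_a], and [eps u] is the element
    [\sum_a a . T u_a] of [A]. The object [Y] is the quotient of [S] by the
    images of the relations, the [u] with [eps u = 0], and [a] in [A] is sent
    to the class of the injection at [a]. *)
Lemma hom_essentially_surjective (A : lmodType (endo (T U))^c) :
  exists (Y : G) (b : A -> hom_from (T U) (T Y)), linear b /\ bijective b.
Proof.
have [S [inj cop]] := hcop (fun _ : A => U).
have [p [p1 p0 fin]] := copower_finite hC hAB5 hUnoeth cop.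
have [r rP] := choice fin.
pose sc (f : phom (T U) (T U)) (x : A) : A := (f : (endo (T U))^c) *: x.
have sc0 x : sc 0 x = 0 by exact: scale0r.
have scD f g x : sc (f + g) x = sc f x + sc g x by exact: scalerDl.
have scM f g x : sc (f ∘ g) x = sc g (sc f x) by rewrite /sc scalerA.
have sc1 x : sc (idm _) x = x by exact: scale1r.
have sc_inj (s : phom U U) x : mono s -> sc (amap T s) x = 0 -> x = 0.
  by move=> /Tiso[t [ts st]] sx; rewrite -[x]sc1 -st scM sx /sc scaler0.
pose eps (u : phom U S) : A := \sum_(a <- r u) sc (amap T (p a ∘ u)) a.
have epsE u (r' : seq {classic A}) : uniq r' ->
    (forall a : {classic A}, a \notin r' -> p a ∘ u = 0) ->
    eps u = \sum_(a <- r') sc (amap T (p a ∘ u)) a.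
  move=> r'U r'0; have [rU r0 _] := rP u.
  by apply: sum_support => // a; [move/r0 | move/r'0] => ->; rewrite amap0 sc0.
have epsD u v : eps (u + v) = eps u + eps v.
  have [_ ru0 _] := rP u; have [_ rv0 _] := rP v; pose r' := undup (r u ++ r v).
  have [u0 v0] : (forall a : {classic A}, a \notin r' -> p a ∘ u = 0) /\
      (forall a : {classic A}, a \notin r' -> p a ∘ v = 0).
    split=> a; rewrite mem_undup mem_cat negb_or => /andP[au av].
      exact: ru0.
    exact: rv0.
  rewrite !(epsE _ r') ?undup_uniq //.
    by rewrite -big_split; apply: eq_bigr => a _; rewrite /= mcompDr amapD scD.
  by move=> a ar'; rewrite mcompDr u0 // v0 // addr0.
have epsM u (g : phom U U) : eps (u ∘ g) = sc (amap T g) (eps u).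
  have [rU r0 _] := rP u; rewrite (epsE _ (r u)) //; last first.
    by move=> a ar; rewrite mcompA r0 // comp0m.
  rewrite /sc scaler_sumr; apply: eq_bigr => a _.
  by rewrite -/(sc _ _) mcompA amapM scM.
have eps0 : eps 0 = 0 by apply: (addIr (eps 0)); rewrite -epsD !add0r.
have eps_inj x : eps (inj x) = x.
  rewrite (epsE _ [:: x]) ?big_seq1 ?p1 ?amap1 ?sc1 // => a.
  by rewrite inE => /eqP ax; exact: p0.
have epsN u : eps (- u) = - eps u.
  by apply: (addIr (eps u)); rewrite -epsD !addNr.
have [S' [inj' cop']] := hcop (fun _ : {u : phom U S | eps u = 0} => U).
have [p' [_ _ fin']] := copower_finite hC hAB5 hUnoeth cop'.
have [k [kinj _]] := cop' S (fun u => sval u).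
have [Y [c cC]] := ex_cokernel hC k; have cE := cokernel_epi cC.
(* No relations arise in [Y] beyond those imposed, up to denominators. *)
have epsP w : amap T (c ∘ w) = 0 <-> eps w = 0.
  split=> [/T0[s [sM cws0]]|w0]; last first.
    have /= <- := kinj (exist _ w w0).
    by rewrite mcompA cC.1 comp0m amap0.
  have [I [e [m [eE mM kE]]]] := ex_image hC k.
  have mC : is_cokernel m c.
    split; first by apply: (epi0P _).1 eE _ _ _; rewrite -mcompA -kE cC.1.
    move=> X t tm0; have [|u uc] := @cokernel_desc _ _ _ _ _ _ _ t cC.
      by rewrite kE mcompA tm0 comp0m.
    by exists u; split=> // v vc; apply: cE; rewrite uc vc.
  have [|x mx] := @kernel_lift _ _ _ _ _ _ _ (w ∘ s) (mono_is_kernel hC mM mC).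
    by rewrite mcompA.
  have [s' [y [s'M xs']]] := lift x eE.
  apply: (sc_inj s) => //; apply: (sc_inj s') => //.
  rewrite -!epsM -mx -mcompA xs'.
  rewrite mcompA -kE; have [r' [_ _ ->]] := fin' y; rewrite comp_sumr.
  apply: (big_ind (fun u => eps u = 0)) => // [u v u0 v0|u _].
    by rewrite epsD u0 v0 addr0.
  by rewrite mcompA kinj epsM (svalP u) /sc scaler0.
pose b (a : A) : hom_from (T U) (T Y) := amap T (c ∘ inj a).
have epsB u v : eps u = eps v -> amap T (c ∘ u) = amap T (c ∘ v).
  move=> uv; apply/subr0_eq; rewrite -amapB -compmB; apply/epsP.
  by rewrite epsD epsN uv subrr.
have bD x y : b (x + y) = b x + b y.
  rewrite /b -[RHS]amapD -mcompDr; apply: epsB.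
  by rewrite epsD !eps_inj.
have bM f x : b (sc f x) = (b x : phom _ _) ∘ f.
  have [s [h [sM fs]]] := frac f; apply: (Tcancel sM).
  rewrite -mcompA fs -!amapM -!mcompA; apply: epsB.
  by rewrite !epsM !eps_inj -scM fs.
exists Y, b; split; first by move=> f x y; rewrite bD; congr (_ + _); exact: bM.
have b0 x : b x = 0 -> x = 0 by move=> /epsP; rewrite eps_inj.
have bI : injective b.
  move=> x y bxy; apply/subr0_eq/b0/(addIr (b y)).
  by rewrite -bD subrK add0r.
have b_surj f : exists x, b x = f.
  have [s [h [sM fs]]] := frac f; have [s' [u [s'M hs]]] := lift h cE.
  have [t [ts st]] := Tiso (mono_comp sM s'M).
  exists (sc t (eps u)); rewrite bM.
  rewrite -[f]mcomp1r -st mcompA; congr (_ ∘ _).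
  rewrite amapM mcompA fs -amapM hs; apply: epsB.
  by rewrite eps_inj.
have [g gP] := choice b_surj.
by exists g => [x|y] //; apply: bI; rewrite gP.
Qed.

Lemma hom_functor_equivalence : is_equivalence (hom_functor (T U)).
Proof.
apply: equivalence_of_fully_faithful.
- move=> X Y; move: X; apply: quotient_ind => M; move: Y; apply: quotient_ind => N.
  move=> f g fg; apply/subr0_eq.
  apply: (hom_faithful hG hUnoeth hUgen hUns hUec hT) => h.
  rewrite compBm; apply/eqP; rewrite subr_eq0; apply/eqP.
  have := congr1 (fun k : {linear hom_from (T U) (T M) ->
    hom_from (T U) (T N)} => k (amap T h)) fg.
  exact.
- move=> X Y; move: X; apply: quotient_ind => M; move: Y; apply: quotient_ind => N.
  move=> a; have [||f fP] := hom_full hG hUnoeth hUgen hUns hUec hT (a := a).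
  + by move=> f g; exact: (linearD a).
  + move=> f e; exact: (linearZZ
      (a : {linear hom_from (T U) (T M) -> hom_from (T U) (T N)})
      (e : (endo (T U))^c) f).
  by exists f; apply: linear_map_eq; apply: funext => g; rewrite /= /hom_post fP.
- move=> A; have [Y [b [bL [g bK gK]]]] := hom_essentially_surjective A.
  have [|f [h [hf fh]]] := @linear_bijective_iso _ _ _ b bL; first by exists g.
  by exists (T Y), h, f.
Qed.

End GoldieQuotientRing.

Theorem theorem8p15 (G : preadditive) (hG : grothendieck_category G)
  (hnoeth : exists V : G, noetherian V /\ generator V)
  (hred : atomically_reduced G)
  (GGoldie : preadditive) (i : additive_functor G GGoldie)
  (hi : is_gabriel_quotient (@goldie_localizing G) i)
  (U : G) (hUnoeth : noetherian U) (hUgen : generator U)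
  (hUns : nonsingular U) (hUec : essentially_compressible U) :
  [/\ is_classical_right_quotient_ring
        (endo_map i : {rmorphism endo U -> endo (i U)}),
      semisimple_artinian (endo (i U))
    & is_equivalence (hom_functor (i U))].
Proof.
split.
- exact: endo_classical_quotient.
- by apply: idempotent_semisimple_artinian; exact: endo_idempotent_ideals.
- exact: hom_functor_equivalence.
Qed.
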